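(* Let $\mathcal L$ be a lattice on $\mathbb X$, let $p\in(1,\infty)$, let $T$ be a martingale transform bounded in $L^p$, and let $b$ be a locally integrable function. If the formal sum $b_0:=\sum_{I\in\mathcal L}\Delta_I b$ is in $\mathcal{BMO}=\mathcal{BMO}_2$, then the commutator $[M_b,T]=M_bT-TM_b$ is bounded in $L^p$. Moreover, $$\|[M_b,T]\|_{L^p\to L^p}\le C\,\|T\|_{L^p\to L^p}\,\|b_0\|_{\mathcal{BMO}},$$ where $C=C(p)$ depends only on $p$.
   Context: Setting. $\mathbb X$ is $\mathbb R$ or a (finite or infinite) subinterval of $\mathbb R$; $|\cdot|$ is Lebesgue measure. A lattice $\mathcal L$ on $\mathbb X$ is a collection of non-trivial bounded intervals (of the form $[a,b)$) in $\mathbb X$ that is a union of generations $\mathcal L_k$, $k\in\mathbb Z$, where each $\mathcal L_k$ is a collection of disjoint intervals covering $\mathbb X$, and each $I\in\mathcal L_k$ is a finite disjoint union of intervals $J\in\mathcal L_{k+1}$ (possibly just one, $J=I$). The rank $\mathrm{rk}(I)$ is the largest $k$ with $I\in\mathcal L_k$; if $\mathrm{rk}(I)=k$, the children of $I$ are the $J\in\mathcal L_{k+1}$ with $J\subset I$ (hence $J\subsetneq I$), and $I$ is called the parent of each of them. (If $I\in\mathcal L_k$ for all large $k$, then $I$ has no children and $\Delta_I:=0$.) Put $\langle f\rangle_I=|I|^{-1}\int_I f\,dx$, $\mathbb E_I f=\langle f\rangle_I\mathbf 1_I$, $\Delta_I f=\sum_{J\in\mathrm{child}(I)}\mathbb E_J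 f-\mathbb E_I f$, and $D_I=\Delta_I L^2$ (functions supported on $I$, constant on each child of $I$, with integral $0$). $\mathfrak A^{0}_{-\infty}$ is the collection of all intervals $\bigcup_{k\in\mathbb Z}I_k$ with $I_k\in\mathcal L_k$, $I_k\subset I_{k-1}$, and $\mathfrak A^{0,\mathrm{fin}}_{-\infty}=\{I\in\mathfrak A^0_{-\infty}:|I|<\infty\}$. All functions are assumed Borel and constant on every interval of the form $\bigcap_k I_k$, $I_k\in\mathcal L_k$, $I_k\subset I_{k-1}$. Locally integrable means integrable on every $I\in\mathcal L$. Martingale transforms and commutators. Call $f$ a finite sum if $f=\sum_{I\in\mathcal L}\Delta_I f+\sum_{I\in\mathfrak A^{0,\mathrm{fin}}_{-\infty}}\mathbb E_I f$ with finitely many non-zero terms. A martingale transform is a linear operator $Tf=\sum_{I\in\mathcal L}T_I(\Delta_I f)$ with linear blocks $T_I:D_I\to D_I$ (so $T\mathbb E_I f=0$ for $I\in\mathfrak A^{0,\mathrm{fin}}_{-\infty}$). Its adjoint $T^*$ with respect to $\langle f,g\rangle=\int_{\mathbb X}fg\,dx$ has blocks $T_I^*$. $M_b f=bf$; the commutator $[M_b,T]$ is bounded in $L^p$ with norm $N$ if $N$ is the smallest constant such that $|\langle bTf,g\rangle-\langle bf,T^*g\rangle|\le N\|f\|_p\|g\|_{p'}$ for all finite sums $f,g$ ($1/p+1/p'=1$). BMO. For a formal sum $f=\sum_{I\in\mathcal L}\Delta_I f$ with $\Delta_I f\in D_I$, let $x_J$ be the value of $\Delta_I f$ on $J$ when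 $J$ is a child of $I$ (and $x_J=0$ if $J$ has no parent). Then $f\in\mathcal{BMO}_2$ if $\|f\|_{\mathcal{BMO}}:=\sup_{J\in\mathcal L}\bigl(\frac1{|J|}\sum_{I\in\mathcal L,\,I\subset J}|x_I|^2|I|\bigr)^{1/2}<\infty$. *)

(* Defs.v *)
From HB Require Import structures.
From mathcomp Require Import all_boot all_order all_algebra.
From mathcomp Require Import all_classical all_reals all_analysis.
Set Implicit Arguments.
Unset Strict Implicit.
Unset Printing Implicit Defensive.
Import Order.TTheory GRing.Theory Num.Theory.
Import numFieldNormedType.Exports.
Local Open Scope classical_set_scope.
Local Open Scope ring_scope.

(* The data of a lattice is its family of generations; the lattice itself,
   as a collection of intervals, is the union [mem_lattice] below. *)
Record lattice (R : realType) (X : set R) := Lattice {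
  gen :> int -> set (set R) ;
  gen_itv : forall k I, gen k I -> exists a b : R, a < b /\ I = [set` `[a, b[] ;
  gen_disj : forall k I J, gen k I -> gen k J -> I `&` J !=set0 -> I = J ;
  gen_cover : forall k, \bigcup_(I in gen k) I = X ;
  gen_refine : forall k I, gen k I ->
    exists F : set (set R),
      [/\ finite_set F, F `<=` gen (k + 1) & I = \bigcup_(J in F) J] }.

Section Lattice.
Context {R : realType} {X : set R} (L : lattice X).
Implicit Types (I J : set R) (f g b : R -> R).

Local Notation mu := (@lebesgue_measure R).

Definition mem_lattice : set (set R) := \bigcup_(k in [set: int]) L k.

Definition is_rank I (k : int) : Prop :=
  L k I /\ forall m, L m I -> m <= k.

(* Empty when [I] has no rank, i.e. lies in all generations of large index. *)
Definition child I : set (set R) :=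
  [set J | exists k, [/\ is_rank I k, L (k + 1) J & J `<=` I]].

Definition is_chain (s : int -> set R) : Prop :=
  forall k, L k (s k) /\ s k `<=` s (k - 1).

(* The collections A^0_{-oo} and A^{0,fin}_{-oo}. *)
Definition top_intervals : set (set R) :=
  [set I | exists2 s, is_chain s & I = \bigcup_(k in [set: int]) s k].

Definition fin_top_intervals : set (set R) :=
  [set I | top_intervals I /\ (mu I < +oo)%E].

(* The standing assumption on functions: Borel on [X], and constant on
   the intersections of decreasing chains of the lattice. *)
Definition admissible f : Prop :=
  measurable_fun X f /\
  forall s, is_chain s ->
    forall x y, (\bigcap_(k in [set: int]) s k) x ->
                (\bigcap_(k in [set: int]) s k) y -> f x = f y.

Definition lattice_integrable f : Prop :=
  forall I, mem_lattice I -> mu.-integrable I (EFin \o f).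

Definition avg I f : R := (fine (mu I))^-1 * \int[mu]_(x in I) f x.

Definition Expect I f : R -> R := fun x => avg I f * \1_I x.

Definition Delta I f : R -> R := fun x =>
  if `[< child I !=set0 >]
  then \sum_(J \in child I) Expect J f x - Expect I f x
  else 0.

(* Functions on [X] are represented by total functions on [R], whose values
   outside [X] are irrelevant: norms and pairings only see [X]. *)
Definition Lpnorm (p : \bar R) f : \bar R := 'N[mu]_p [EFin \o (f \_ X)].

Definition pairing f g : R := \int[mu]_(x in X) (f x * g x).

Definition Dspace I : set (R -> R) :=
  [set u | exists f, [/\ admissible f,
     (Lpnorm 2%:E f < +oo)%E & u = Delta I f]].

Definition finite_sum f : Prop :=
  [/\ admissible f,
      (forall I, mem_lattice I \/ fin_top_intervals I ->
         mu.-integrable I (EFin \o f)),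
      finite_set [set I | mem_lattice I /\ Delta I f <> cst 0],
      finite_set [set I | fin_top_intervals I /\ Expect I f <> cst 0] &
      forall x, X x ->
        f x = \sum_(I \in mem_lattice) Delta I f x
              + \sum_(I \in fin_top_intervals) Expect I f x].

Record martingale_transform := MartingaleTransform {
  block : set R -> (R -> R) -> (R -> R) ;
  block_stable : forall I, mem_lattice I ->
    forall u, Dspace I u -> Dspace I (block I u) ;
  block_linear : forall I, mem_lattice I ->
    forall (a : R) u v, Dspace I u -> Dspace I v ->
      block I (fun x => a * u x + v x) =
      (fun x => a * block I u x + block I v x) }.

(* Only used for [f] a finite sum, where the sum is finite. *)
Definition apply_blocks (B : set R -> (R -> R) -> (R -> R)) f : R -> R :=
  fun x => \sum_(I \in mem_lattice) B I (Delta I f) x.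

Definition transform (T : martingale_transform) f : R -> R :=
  apply_blocks (block T) f.

(* On [D_I] this is the adjoint of the block [T_I], which exists and is unique
   because [D_I] is a finite-dimensional inner product space. *)
Definition adjoint_block (T : martingale_transform) I (v : R -> R) : R -> R :=
  xget (cst 0) [set w | Dspace I w /\
    forall u, Dspace I u -> pairing (block T I u) v = pairing u w].

Definition adjoint_transform (T : martingale_transform) g : R -> R :=
  apply_blocks (adjoint_block T) g.

(* The least constant [N >= 0] with ||T f||_p <= N ||f||_p for all finite sums
   f, and +oo if there is no such constant. *)
Definition transform_norm (p : R) (T : martingale_transform) : \bar R :=
  ereal_inf [set N%:E | N in [set N : R | 0 <= N /\
    forall f, finite_sum f ->
      (Lpnorm p%:E (transform T f) <= N%:E * Lpnorm p%:E f)%E]].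

Definition commutator_form b (T : martingale_transform) f g : R :=
  pairing (fun x => b x * transform T f x) g
  - pairing (fun x => b x * f x) (adjoint_transform T g).

(* Likewise, +oo if the commutator is not bounded. *)
Definition commutator_norm (p : R) b (T : martingale_transform) : \bar R :=
  ereal_inf [set N%:E | N in [set N : R | 0 <= N /\
    forall f g, finite_sum f -> finite_sum g ->
      (`|commutator_form b T f g|%:E
         <= N%:E * Lpnorm p%:E f * Lpnorm (hoelder_conjugate p%:E) g)%E]].

(* A formal sum is the family [u] of its terms, [u I] in [D_I]. An interval has
   at most one parent, so [xget] picks the parent; any point of [J] can be
   used to read off the value of [u I] on its child [J]. *)
Definition jump (u : set R -> R -> R) J : R :=
  if `[< exists I, child I J >]
  then u (xget set0 [set I | child I J]) (xget 0 J)
  else 0.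

Definition BMO_norm (u : set R -> R -> R) : \bar R :=
  ereal_sup [set
    (((fine (mu J))^-1)%:E *
      \esum_(I in [set I | mem_lattice I /\ I `<=` J])
        (`|jump u I| ^+ 2 * fine (mu I))%:E) `^ 2^-1 | J in mem_lattice]%E.

End Lattice.

Arguments Lpnorm {R} X p f.
Arguments pairing {R} X f g.

(* Main.v *)
(** The commutator form of two finite sums lives on finitely many intervals of
    the lattice between two generations, that is, on a finite weighted set
    filtered by finitely many partitions.  There, expanding [b f g] along the
    filtration, the part containing the averages of [b] is a diagonal operator
    and cancels in the commutator, because the blocks of [T] commute with
    multiplication by constants on each interval.  What remains is
    [P (T f) g - P f (T^* g)] with the paraproduct form
      [P f g = \sum_k \int Delta_k b * (E_{k+1} f E_{k+1} g - E_k f E_k g)].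
    Its increments are bounded by [|Delta_k f| g^* + f^* |Delta_k g|] with the
    running maxima [f^*], [g^*].  A weighted arithmetic-geometric mean
    inequality separates [Delta_k b] from [Delta_k f]: the square function of
    [b] against an increasing adapted weight is controlled by BMO, and that of
    [f] is weighted by a negative power of [f^*] if [p <= 2] (Abel summation)
    and by a positive power of [g^*] if [p > 2] (the BMO argument again).
    Doob's maximal inequality concludes.  The bound for [T^*] follows by
    duality, testing against centered step functions, which are finite sums. *)

Require Import Defs.
From HB Require Import structures.
From mathcomp Require Import all_boot all_order all_algebra.
From mathcomp Require Import all_classical all_reals all_analysis.
From mathcomp Require Import measurable_realfun ring lra.
Import Order.TTheory GRing.Theory Num.Theory.
Import numFieldNormedType.Exports.
Local Open Scope classical_set_scope.
Local Open Scope ring_scope.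

Set Implicit Arguments.
Unset Strict Implicit.
Unset Printing Implicit Defensive.

(** * Real inequalities *)

Section RealInequalities.
Context {R : realType}.
Implicit Types x y z p : R.

(** The lattice has no regularity: a child may be arbitrarily small compared with its parent, so
    running maxima of levels [k] and [k + 1] are not comparable, and the weight paired with the
    difference of level [k] has to be taken at level [k + 1]. The BMO norm allows this because its
    sum over [I] below [J] counts the jump into [J] itself. For a general function a single jump is
    at most twice the maximum, which serves the same purpose. The case distinction at [p = 2] comes
    from the weight on the differences of [f]: summation by parts against tails needs an increasing
    weight, whereas the exponent [p - 2] gives a decreasing one when [p < 2]. [T] is controlled on
    finite sums only. A step function on the window is guaranteed to be one after its averages over
    the coarsest intervals are removed; this projection contributes its own factor to the constant.
    The operator norm and the BMO norm are replaced by strictly larger numbers, which keeps the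
    divisor [B] positive; the limit is taken at the very end. *)

Lemma mul_powR_le_young p x y : 1 < p -> 0 <= x -> 0 <= y ->
  x * y `^ (p - 1) <= x `^ p / p + y `^ p * (1 - p^-1).
Proof.
move=> p1 x0 y0; have p0 : 0 < p by lra.
have q0 : 0 < (1 - p^-1)^-1 by rewrite invr_gt0 subr_gt0 invf_lt1.
have := @conjugate_powR R x (y `^ (p - 1)) p (1 - p^-1)^-1 x0 (powR_ge0 _ _) p0 q0.
rewrite invrK -powRrM; have -> : (p - 1) * (1 - p^-1)^-1 = p.
  by field; rewrite !gt_eqF ?subr_gt0.
by apply; lra.
Qed.

Lemma conjugate_exponentK p : 1 < p -> (p / (p - 1)) / (p / (p - 1) - 1) = p.
Proof.
move=> p1; have p1N0 : p - 1 != 0 by rewrite gt_eqF ?subr_gt0.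
have -> : p / (p - 1) - 1 = (p - 1)^-1 by field.
by rewrite invrK divfK.
Qed.

Lemma conjugate_exponent_gt1 p : 1 < p -> 1 < p / (p - 1).
Proof. by move=> p1; rewrite ltr_pdivlMr ?subr_gt0//; lra. Qed.

(** All three powers agree at the threshold [y = x^(p-1)]. Below it the first term on the right
    dominates, above it the second. *)
Lemma powR_mixed_le p x y : 1 < p <= 2 -> 0 <= x -> 0 <= y ->
  x `^ (2 - p) * y ^+ 2 <= x `^ p + y `^ (p / (p - 1)).
Proof.
move=> /andP[p1 p2] x0 y0.
have p0 : 0 < p by lra.
have pm0 : 0 < p - 1 by lra.
set q := p / (p - 1).
have q0 : 0 < q by rewrite divr_gt0.
have [y_le|x_lt] := leP y (x `^ (p - 1)).
  apply: (@le_trans _ _ (x `^ p)); last by rewrite lerDl powR_ge0.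
  have -> : x `^ p = x `^ (2 - p) * (x `^ (p - 1)) ^+ 2.
    rewrite -powR_mulrn ?powR_ge0// -powRrM -powRD; last by apply/implyP; lra.
    by congr powR; ring.
  by rewrite ler_wpM2l ?powR_ge0// ler_pXn2r// nnegrE powR_ge0.
apply: (@le_trans _ _ (y `^ q)); last by rewrite lerDr powR_ge0.
have yN0 : y != 0 by rewrite gt_eqF// (le_lt_trans _ x_lt)// powR_ge0.
have -> : y `^ q = y `^ ((2 - p) / (p - 1)) * y ^+ 2.
  rewrite -powR_mulrn// -powRD ?yN0 ?implybT//; congr powR.
  by rewrite /q; field; rewrite gt_eqF.
rewrite ler_wpM2r ?exprn_ge0//.
have -> : x `^ (2 - p) = (x `^ (p - 1)) `^ ((2 - p) / (p - 1)).
  by rewrite -powRrM; congr powR; field; rewrite gt_eqF.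
by rewrite ge0_ler_powR ?nnegrE ?powR_ge0 ?divr_ge0//; lra.
Qed.

(** The left side is [z y^(p-1) - y z^(p-1)]; Young's inequality bounds the first product,
    monotonicity the second. This pays for the drop of the weight of exponent [p - 2] when the
    running maximum grows from [y] to [z]. *)
Lemma powR_decrement_le p y z : 1 < p <= 2 -> 0 <= y <= z ->
  y * z * (y `^ (p - 2) - z `^ (p - 2)) <= (z `^ p - y `^ p) / p.
Proof.
move=> /andP[p1 p2] /andP[y0 yz].
have p0 : 0 < p by lra.
move: y0; rewrite le_eqVlt => /predU1P[<-|y0].
  by rewrite !mul0r powR0 ?gt_eqF// subr0 divr_ge0 ?powR_ge0 ?ltW.
have z0 : 0 < z by lra.
have step (t : R) : 0 < t -> t * t `^ (p - 2) = t `^ (p - 1).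
  move=> t0; rewrite -[X in X * _]powRr1 ?ltW// -powRD ?(gt_eqF t0) ?implybT//.
  by congr powR; ring.
have stepp (v : R) : 0 < v -> v * v `^ (p - 1) = v `^ p.
  by move=> v0; rewrite mulr_powRB1// ltW.
have -> : y * z * (y `^ (p - 2) - z `^ (p - 2)) = z * y `^ (p - 1) - y * z `^ (p - 1).
  by rewrite -!step//; ring.
have Y := mul_powR_le_young p1 (ltW z0) (ltW y0).
have Z : y `^ p <= y * z `^ (p - 1).
  rewrite -stepp//; apply: ler_wpM2l; first exact: ltW.
  by apply: ge0_ler_powR; rewrite ?nnegrE; lra.
by move: Y Z; rewrite mulrBl mulrBr mulr1; lra.
Qed.

(** The two summands have a product at least the square of the left side. The parameter [B] balances
    them: differences of the BMO function take the place of [a] and contribute [B^2]. *)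
Lemma amgm_weighted (B a b s t u : R) : 0 < B -> 0 <= s -> 0 <= t -> 0 <= u ->
  u ^+ 2 <= s * t ->
  `|a| * `|b| * u <= (B * (b ^+ 2 * s) + (a ^+ 2 * t) / B) / 2.
Proof.
move=> B0 s0 t0 u0 ust.
rewrite -[a ^+ 2]real_normK ?num_real// -[b ^+ 2]real_normK ?num_real//.
move: `|a| `|b| (normr_ge0 a) (normr_ge0 b) => {}a {}b a0 b0.
have Xsq : (a * b * u) ^+ 2 <= (B * (b ^+ 2 * s)) * ((a ^+ 2 * t) / B).
  have -> : (B * (b ^+ 2 * s)) * ((a ^+ 2 * t) / B) = (a * b) ^+ 2 * (s * t).
    by field; rewrite gt_eqF.
  by rewrite exprMn ler_wpM2l// exprn_ge0// mulr_ge0.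
have P0 : 0 <= B * (b ^+ 2 * s) by rewrite mulr_ge0 ?(ltW B0)// mulr_ge0// exprn_ge0.
have Q0 : 0 <= (a ^+ 2 * t) / B by rewrite divr_ge0 ?(ltW B0)// mulr_ge0// exprn_ge0.
have : (a * b * u) ^+ 2 <= ((B * (b ^+ 2 * s) + (a ^+ 2 * t) / B) / 2) ^+ 2.
  apply: le_trans Xsq _; move: (B * (b ^+ 2 * s)) ((a ^+ 2 * t) / B) => P Q.
  by rewrite -subr_ge0 (_ : _ - _ = ((P - Q) / 2) ^+ 2) ?sqr_ge0//; field.
by rewrite ler_pXn2r// nnegrE ?mulr_ge0 ?divr_ge0 ?addr_ge0.
Qed.

End RealInequalities.

(** * Martingales on a finite weighted space *)

Section FiniteMartingales.
Context {R : realType} {Om : finType} {S : eqType}.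
Context (w : Om -> R) (key : nat -> Om -> S).
Context (w_gt0 : forall o, 0 < w o).
Context (key_refine : forall k o o', key k.+1 o = key k.+1 o' -> key k o = key k o').
Implicit Types (f g h F G : Om -> R) (k m n : nat).

(** * Weighted sums, conditional expectations and Doob's inequality *)

Definition wsum f : R := \sum_o w o * f o.

Definition cexp k f (o : Om) : R :=
  (\sum_(o' | key k o' == key k o) w o' * f o') /
  (\sum_(o' | key k o' == key k o) w o').

Definition mdiff k f (o : Om) : R := cexp k.+1 f o - cexp k f o.

Definition adapted k f : Prop := forall o o', key k o = key k o' -> f o = f o'.

Lemma adaptedS k f : adapted k f -> adapted k.+1 f.
Proof. by move=> fk o o' /key_refine/fk. Qed.

Lemma adapted_le k m f : (k <= m)%N -> adapted k f -> adapted m f.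
Proof.
move=> /subnK <-; elim: (m - k)%N => // j IH fk.
by rewrite addSn; apply/adaptedS/IH.
Qed.

Lemma adapted_cexp k f : adapted k (cexp k f).
Proof. by move=> o o' oo'; rewrite /cexp oo'. Qed.

Lemma adapted_mdiff k f : adapted k.+1 (mdiff k f).
Proof.
move=> o o' oo'; rewrite /mdiff (adapted_cexp f oo').
by rewrite (adapted_cexp f (key_refine oo')).
Qed.

Lemma adapted1 k (phi : R -> R) f : adapted k f -> adapted k (phi \o f).
Proof. by move=> fk o o' oo' /=; rewrite (fk o o'). Qed.

Lemma adapted2 k (phi : R -> R -> R) f g : adapted k f -> adapted k g ->
  adapted k (fun o => phi (f o) (g o)).
Proof. by move=> fk gk o o' oo' /=; rewrite (fk o o')// (gk o o'). Qed.

Lemma eq_wsum f g : f =1 g -> wsum f = wsum g.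
Proof. by move=> fg; apply: eq_bigr => o _; rewrite fg. Qed.

Lemma wsumD f g : wsum (fun o => f o + g o) = wsum f + wsum g.
Proof. by rewrite -big_split; apply: eq_bigr => o _; rewrite mulrDr. Qed.

Lemma wsumZ (a : R) f : wsum (fun o => a * f o) = a * wsum f.
Proof. by rewrite /wsum mulr_sumr; apply: eq_bigr => o _; rewrite mulrCA. Qed.

Lemma wsumB f g : wsum (fun o => f o - g o) = wsum f - wsum g.
Proof. by rewrite -sumrB; apply: eq_bigr => o _; rewrite mulrBr. Qed.

Lemma wsum_sum (I : Type) (r : seq I) (P : pred I) (u : I -> Om -> R) :
  wsum (fun o => \sum_(i <- r | P i) u i o) = \sum_(i <- r | P i) wsum (u i).
Proof.
by rewrite exchange_big; apply: eq_bigr => o _; rewrite mulr_sumr.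
Qed.

Lemma ler_wsum f g : (forall o, f o <= g o) -> wsum f <= wsum g.
Proof. by move=> fg; apply: ler_sum => o _; rewrite ler_pM2l. Qed.

Lemma wsum_ge0 f : (forall o, 0 <= f o) -> 0 <= wsum f.
Proof. by move=> f0; apply: sumr_ge0 => o _; rewrite mulr_ge0 ?(ltW (w_gt0 _)). Qed.

Lemma ler_norm_wsum f : `|wsum f| <= wsum (fun o => `|f o|).
Proof.
apply: le_trans (ler_norm_sum _ _ _) _; apply: ler_sum => o _.
by rewrite normrM (gtr0_norm (w_gt0 o)).
Qed.

Lemma block_weight_gt0 k o : 0 < \sum_(o' | key k o' == key k o) w o'.
Proof.
rewrite (bigD1 o)//= ltr_wpDr// sumr_ge0// => o' _; exact: ltW.
Qed.

Lemma cexp_adapted k f : adapted k f -> cexp k f =1 f.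
Proof.
move=> fk o; rewrite /cexp (eq_bigr (fun o' => w o' * f o)); last first.
  by move=> o' /eqP/fk ->.
by rewrite -mulr_suml mulrAC divff ?mul1r// gt_eqF ?block_weight_gt0.
Qed.

Lemma eq_cexp k f g : f =1 g -> cexp k f =1 cexp k g.
Proof. by move=> fg o; congr (_ / _); apply: eq_bigr => i _; rewrite fg. Qed.

Lemma cexpD k f g o : cexp k (fun o => f o + g o) o = cexp k f o + cexp k g o.
Proof.
rewrite /cexp -mulrDl -big_split; congr (_ / _).
by apply: eq_bigr => i _; rewrite mulrDr.
Qed.

Lemma cexpB k f g o : cexp k (fun o => f o - g o) o = cexp k f o - cexp k g o.
Proof.
rewrite /cexp -mulrBl -sumrB; congr (_ / _).
by apply: eq_bigr => i _; rewrite mulrBr.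
Qed.

Lemma cexpZ k (a : R) f o : cexp k (fun o => a * f o) o = a * cexp k f o.
Proof.
rewrite /cexp mulrA mulr_sumr; congr (_ / _).
by apply: eq_bigr => i _; rewrite mulrCA.
Qed.

Lemma ler_norm_cexp k f o : `|cexp k f o| <= cexp k (fun o => `|f o|) o.
Proof.
rewrite normrM [`|_^-1|]gtr0_norm ?invr_gt0 ?block_weight_gt0//.
rewrite ler_pM2r ?invr_gt0 ?block_weight_gt0//.
apply: le_trans (ler_norm_sum _ _ _) _; apply: ler_sum => i _.
by rewrite normrM (gtr0_norm (w_gt0 i)).
Qed.

Lemma cexp_ge0 k f o : (forall o, 0 <= f o) -> 0 <= cexp k f o.
Proof.
by move=> f0; rewrite divr_ge0 ?(ltW (block_weight_gt0 _ _))// sumr_ge0// => i _;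
  rewrite mulr_ge0 ?(ltW (w_gt0 _)).
Qed.

Lemma wsum_cexp k f h : adapted k h ->
  wsum (fun o => cexp k f o * h o) = wsum (fun o => f o * h o).
Proof.
move=> hk; pose Wt o := \sum_(o' | key k o' == key k o) w o'.
transitivity
    (\sum_o \sum_(o' | key k o' == key k o) (w o' * f o') * (w o * h o / Wt o)).
  apply: eq_bigr => o _; rewrite -mulr_suml /cexp -/(Wt o); ring.
rewrite (exchange_big_dep xpredT)//=; apply: eq_bigr => o _.
rewrite -mulr_sumr -mulrA; congr (_ * (_ * _)).
rewrite (eq_bigr (fun o' => w o' * (h o / Wt o))); last first.
  by move=> o' /eqP e; rewrite (hk _ _ e) /Wt e mulrA.
rewrite -mulr_suml (eq_bigl (fun o' => key k o' == key k o)); last first.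
  by move=> o'; rewrite eq_sym.
by rewrite -/(Wt o) mulrCA divff ?mulr1// gt_eqF ?block_weight_gt0.
Qed.

Lemma wsum_cexpr k f h : adapted k h ->
  wsum (fun o => h o * cexp k f o) = wsum (fun o => h o * f o).
Proof.
move=> hk; transitivity (wsum (fun o => cexp k f o * h o)).
  by apply: eq_wsum => o; rewrite mulrC.
by rewrite wsum_cexp//; apply: eq_wsum => o; rewrite mulrC.
Qed.

Lemma wsum_mdiff k f h : adapted k h -> wsum (fun o => h o * mdiff k f o) = 0.
Proof.
move=> hk; rewrite (eq_wsum (g := fun o => h o * cexp k.+1 f o - h o * cexp k f o)).
  by rewrite wsumB !wsum_cexpr ?subrr//; exact: adaptedS.
by move=> o; rewrite mulrBr.
Qed.

Lemma cexp_sum_mdiff m f o : cexp m f o = cexp 0 f o + \sum_(k < m) mdiff k f o.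
Proof.
elim: m => [|m IH]; first by rewrite big_ord0 addr0.
by rewrite big_ord_recr/= addrA -IH addrC subrK.
Qed.

(* The running maximum is taken over the conditional expectations of [|f|],
   a nonnegative submartingale dominating the martingale of [f]. *)
Fixpoint runmax f k (o : Om) : R :=
  if k is m.+1 then Num.max (runmax f m o) (cexp k (fun o => `|f o|) o)
  else cexp 0 (fun o => `|f o|) o.

Lemma cexp_le_runmax f k o : cexp k (fun o => `|f o|) o <= runmax f k o.
Proof. by case: k => [|k]//=; rewrite le_max lexx orbT. Qed.

Lemma norm_cexp_le_runmax f k o : `|cexp k f o| <= runmax f k o.
Proof. exact: le_trans (ler_norm_cexp _ _ _) (cexp_le_runmax _ _ _). Qed.

Lemma runmaxS f k o : runmax f k o <= runmax f k.+1 o.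
Proof. by rewrite /= le_max lexx. Qed.

Lemma runmax_le f k m o : (k <= m)%N -> runmax f k o <= runmax f m o.
Proof.
move=> /subnK <-; elim: (m - k)%N => // j IH; rewrite addSn.
exact: le_trans IH (runmaxS _ _ _).
Qed.

Lemma runmax_ge0 f k o : 0 <= runmax f k o.
Proof. by apply: le_trans (cexp_le_runmax _ _ _); exact: cexp_ge0. Qed.

Lemma adapted_runmax f k : adapted k (runmax f k).
Proof.
elim: k => [|k IH]; first exact: adapted_cexp.
by apply: adapted2; [exact: adaptedS|exact: adapted_cexp].
Qed.

Lemma norm_mdiff_le f k o : `|mdiff k f o| <= runmax f k o + runmax f k.+1 o.
Proof.
by rewrite addrC; apply: le_trans (ler_normB _ _) _; apply: lerD;
  exact: norm_cexp_le_runmax.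
Qed.

(* Since the running maximum only increases when it equals the current value,
   [\int |f| Y^(p-1)] telescopes from below to [\int Y^p] up to a factor. *)
Lemma wsum_runmax_powR_le (p : R) f m : 1 < p ->
  (1 - p^-1) * wsum (fun o => runmax f m o `^ p)
  <= wsum (fun o => `|f o| * runmax f m o `^ (p - 1)).
Proof.
move=> p1; have p0 : 0 < p by lra.
have q1 : 0 <= p^-1 <= 1 by rewrite invr_ge0 (ltW p0)/= invf_le1// ltW.
have stepp (v : R) : 0 <= v -> v * v `^ (p - 1) = v `^ p.
  by move=> v0; rewrite mulr_powRB1.
have ada k : adapted k (fun o => runmax f k o `^ (p - 1)).
  by apply: (adapted1 (fun y : R => y `^ (p - 1))); exact: adapted_runmax.
elim: m => [|m IH].
  rewrite -(wsum_cexp _ (ada 0%N)) -wsumZ; apply: ler_wsum => o.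
  rewrite [X in _ <= X * _](_ : _ = runmax f 0 o)// stepp ?runmax_ge0//.
  by rewrite ler_piMl ?powR_ge0//; lra.
pose A k o := runmax f k o `^ (p - 1).
have -> : wsum (fun o => `|f o| * A m.+1 o) = wsum (fun o => `|f o| * A m o) +
    wsum (fun o => cexp m.+1 (fun o => `|f o|) o * (A m.+1 o - A m o)).
  rewrite wsum_cexp -?wsumD; last first.
    by apply: (adapted2 (fun x y => x - y)); [exact: ada|exact/adaptedS/ada].
  by apply: eq_wsum => o; ring.
apply: le_trans (lerD IH (lexx _)).
rewrite -lerBlDl -mulrBr -wsumB -wsumZ; apply: ler_wsum => o; rewrite /A/=.
move: (runmax_ge0 f m o) (cexp_ge0 m.+1 o (fun o => normr_ge0 (f o))).
move: (runmax f m o) (cexp _ _ o) => y x y0 x0.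
have [yx|xy] := leP y x; last by rewrite !subrr !mulr0.
rewrite !mulrBr stepp//.
have := mul_powR_le_young p1 x0 y0.
by rewrite !mulrBr !mulrBl !mul1r mulr1; lra.
Qed.

Definition lpsum (p : R) f : R := wsum (fun o => `|f o| `^ p).

Lemma lpsumE p f : lpsum p f = wsum (fun o => `|f o| `^ p).
Proof. by []. Qed.

Lemma lpsum_ge0 p f : 0 <= lpsum p f.
Proof. by apply: wsum_ge0 => o; exact: powR_ge0. Qed.

Lemma lpsum_runmax p f m : lpsum p (runmax f m) = wsum (fun o => runmax f m o `^ p).
Proof. by apply: eq_wsum => o; rewrite ger0_norm ?runmax_ge0. Qed.

(** Young's inequality for [2 |f|] reproduces half of the left side, which is absorbed; the factor 2
    is the origin of [2^p]. *)
Lemma doob (p : R) f m : 1 < p ->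
  lpsum p (runmax f m) <= 2 `^ p / (p - 1) * lpsum p f.
Proof.
move=> p1; have p0 : 0 < p by lra.
have := wsum_runmax_powR_le f m p1.
rewrite lpsum_runmax; set Y := wsum _ => H.
have : wsum (fun o => `|f o| * runmax f m o `^ (p - 1)) <=
    2^-1 * (2 `^ p / p * lpsum p f + (1 - p^-1) * Y).
  rewrite /lpsum /Y -!wsumZ -wsumD -wsumZ; apply: ler_wsum => o.
  have := mul_powR_le_young p1 (mulr_ge0 (ler0n R 2) (normr_ge0 (f o))) (runmax_ge0 f m o).
  by rewrite powRM//; lra.
move=> /(le_trans H) {}H.
have {}H : (1 - p^-1) * Y <= 2 `^ p / p * lpsum p f by lra.
rewrite -(ler_pM2l (_ : 0 < 1 - p^-1)) ?subr_gt0 ?invf_lt1//.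
apply: le_trans H _; rewrite le_eqVlt; apply/orP; left; apply/eqP.
by field; rewrite !gt_eqF// subr_gt0.
Qed.

(** * Square functions against adapted weights *)

(** Garsia's lemma, by Abel summation: the increment [V (i+1) - V i] is nonnegative, adapted to
    level [i + 1], and multiplies the tail of [a] starting at [i]. Hence the hypothesis pairs a tail
    from [k] with weights of level [k + 1]. *)
Lemma garsia n (a V : nat -> Om -> R) (Phi : Om -> R) :
  (forall k, adapted k (V k)) ->
  (forall o, 0 <= V 0%N o) -> (forall k o, V k o <= V k.+1 o) ->
  (forall o, 0 <= Phi o) ->
  (forall k h, (k < n)%N -> adapted k.+1 h -> (forall o, 0 <= h o) ->
    wsum (fun o => h o * \sum_(k <= j < n) a j o) <= wsum (fun o => h o * Phi o)) ->
  \sum_(0 <= k < n) wsum (fun o => a k o * V k.+1 o)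
    <= wsum (fun o => Phi o * V n o).
Proof.
move=> Vad V0 Vmon Phi0 H.
have abel o m : \sum_(0 <= k < m) a k o * V k.+1 o =
    V 0%N o * \sum_(0 <= j < m) a j o +
    \sum_(0 <= i < m) (V i.+1 o - V i o) * \sum_(i <= j < m) a j o.
  elim: m => [|m IH]; first by rewrite !big_geq// mulr0 addr0.
  rewrite big_nat_recr//= IH [X in _ = _ * X + _]big_nat_recr//=.
  rewrite [X in _ = _ + X](eq_big_nat _ _ (F2 := fun i =>
      (V i.+1 o - V i o) * (\sum_(i <= j < m) a j o) + (V i.+1 o - V i o) * a m o)).
    rewrite big_split/= -mulr_suml telescope_sumr//.
    rewrite [X in _ = _ + (X + _)]big_nat_recr//= (big_geq (leqnn m)) mulr0 addr0.
    by ring.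
  by move=> i /andP[_ im]; rewrite big_nat_recr//= mulrDr.
(* For [n = 0] the hypothesis is void and cannot be applied to [V 0]; an empty sum is compared with
   a nonnegative one. *)
case: n H => [|n] H.
  by rewrite big_geq// wsum_ge0// => o; rewrite mulr_ge0.
rewrite -wsum_sum (eq_wsum (fun o => abel o n.+1)) wsumD wsum_sum.
apply: (@le_trans _ _ (wsum (fun o => V 0%N o * Phi o) +
    \sum_(0 <= i < n.+1) wsum (fun o => (V i.+1 o - V i o) * Phi o))).
  apply: lerD; first by apply: H => //; exact/adaptedS/Vad.
  rewrite !big_nat; apply: ler_sum => i /andP[_ im]; apply: H => //.
    by apply: (adapted2 (fun x y => x - y)); [|apply: adaptedS]; exact: Vad.
  by move=> o; rewrite subr_ge0.
rewrite -wsum_sum -wsumD le_eqVlt; apply/orP; left; apply/eqP/eq_wsum => o.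
by rewrite -mulr_suml telescope_sumr//; ring.
Qed.

Lemma wsum_sqr_mdiff k f h : adapted k h ->
  wsum (fun o => h o * mdiff k f o ^+ 2) =
  wsum (fun o => h o * (cexp k.+1 f o ^+ 2 - cexp k f o ^+ 2)).
Proof.
move=> hk; apply/eqP; rewrite -subr_eq0 -wsumB.
rewrite (eq_wsum (g := fun o => (- 2 * (h o * cexp k f o)) * mdiff k f o)).
  rewrite wsum_mdiff//; apply: (adapted2 (fun x y => - 2 * (x * y))) => //.
  exact: adapted_cexp.
by move=> o; rewrite /mdiff; ring.
Qed.

Lemma wsum_sqr_tail f h k n : (k <= n)%N -> adapted k h -> (forall o, 0 <= h o) ->
  wsum (fun o => h o * \sum_(k <= j < n) mdiff j f o ^+ 2)
  <= wsum (fun o => h o * runmax f n o ^+ 2).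
Proof.
move=> kn hk h0.
have -> : wsum (fun o => h o * \sum_(k <= j < n) mdiff j f o ^+ 2) =
    wsum (fun o => h o * (cexp n f o ^+ 2 - cexp k f o ^+ 2)).
  rewrite -(subnKC kn); elim: (n - k)%N => [|j IH].
    rewrite addn0; apply: eq_wsum => o; rewrite big_geq// subrr//.
  have hkj : adapted (k + j) h by apply: adapted_le hk; exact: leq_addr.
  rewrite addnS.
  rewrite (eq_wsum (g := fun o => h o * (\sum_(k <= i < k + j) mdiff i f o ^+ 2)
     + h o * mdiff (k + j) f o ^+ 2)); last first.
    by move=> o; rewrite big_nat_recr ?leq_addr//= mulrDr.
  by rewrite wsumD IH (wsum_sqr_mdiff _ hkj) -wsumD; apply: eq_wsum => o; ring.
apply: ler_wsum => o; apply: ler_wpM2l => //.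
have : cexp n f o ^+ 2 <= runmax f n o ^+ 2.
  rewrite -real_normK ?num_real// ler_pXn2r ?nnegrE ?runmax_ge0//.
  exact: norm_cexp_le_runmax.
by have := sqr_ge0 (cexp k f o); lra.
Qed.

Lemma wsum_sqr_tailS f h k n : (k < n)%N -> adapted k.+1 h -> (forall o, 0 <= h o) ->
  wsum (fun o => h o * \sum_(k <= j < n) mdiff j f o ^+ 2)
  <= wsum (fun o => h o * (5 * runmax f n o ^+ 2)).
Proof.
move=> kn hk h0.
rewrite (eq_wsum (g := fun o => h o * mdiff k f o ^+ 2 +
    h o * \sum_(k.+1 <= j < n) mdiff j f o ^+ 2)); last first.
  by move=> o; rewrite big_ltn// mulrDr.
rewrite wsumD; apply: le_trans (lerD (lexx _) (wsum_sqr_tail _ kn hk h0)) _.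
rewrite -wsumD; apply: ler_wsum => o; rewrite -mulrDr; apply: ler_wpM2l => //.
suff : mdiff k f o ^+ 2 <= (2 * runmax f n o) ^+ 2 by rewrite exprMn; lra.
rewrite -real_normK ?num_real// ler_pXn2r ?nnegrE ?mulr_ge0 ?runmax_ge0//.
apply: le_trans (norm_mdiff_le _ _ _) _; rewrite mulr2n mulrDl mul1r.
by apply: lerD; apply: runmax_le => //; exact: ltnW.
Qed.

(** The weight decreases, so [garsia] does not apply. The induction carries the boundary term of the
    summation by parts, the squared martingale times its weight, along with [5 / p] times the power
    of the maximum; bounding both at the end gives 1 + 5 = 6. *)
Lemma wsum_sqr_mdiff_weight_le (p : R) f m : 1 < p <= 2 ->
  \sum_(0 <= k < m) wsum (fun o => mdiff k f o ^+ 2 * runmax f k.+1 o `^ (p - 2))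
  <= 6 * lpsum p (runmax f m).
Proof.
move=> p12; have /andP[p1 p2] := p12; have p0 : 0 < p by lra.
have Yp (y : R) : 0 <= y -> y ^+ 2 * y `^ (p - 2) = y `^ p.
  move=> y0; rewrite -powR_mulrn// -powRD; first by congr powR; ring.
  by apply/implyP; lra.
rewrite lpsum_runmax.
suff H : \sum_(0 <= k < m) wsum (fun o => mdiff k f o ^+ 2 * runmax f k.+1 o `^ (p - 2))
    <= wsum (fun o => cexp m f o ^+ 2 * runmax f m o `^ (p - 2)) +
       wsum (fun o => 5 / p * runmax f m o `^ p).
  apply: le_trans H _; rewrite -wsumD -wsumZ; apply: ler_wsum => o.
  apply: (@le_trans _ _ (runmax f m o `^ p + 5 * runmax f m o `^ p)); last by lra.
  apply: lerD.
    rewrite -[leRHS]Yp ?runmax_ge0// ler_wpM2r ?powR_ge0//.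
    rewrite -real_normK ?num_real// ler_pXn2r ?nnegrE ?runmax_ge0//.
    exact: norm_cexp_le_runmax.
  by rewrite ler_wpM2r ?powR_ge0// ler_pdivrMr//; lra.
elim: m => [|m IH].
  rewrite big_geq// addr_ge0// wsum_ge0// => o; first by rewrite mulr_ge0 ?sqr_ge0 ?powR_ge0.
  by rewrite mulr_ge0 ?powR_ge0 ?divr_ge0// ltW.
rewrite big_nat_recr//=; apply: le_trans (lerD IH (lexx _)) _.
(* This term has mean zero since its coefficient is adapted to level [m]. Adding it leaves the cross
   term multiplied by the decrement of the weight, not by the weight itself. *)
pose h o := - 2 * (cexp m f o * runmax f m o `^ (p - 2)).
have H0 : wsum (fun o => h o * mdiff m f o) = 0.
  apply: wsum_mdiff; apply: (adapted2 (fun x y => - 2 * (x * y `^ (p - 2)))).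
    exact: adapted_cexp.
  exact: adapted_runmax.
rewrite -[leRHS]addr0 -H0 -!wsumD; apply: ler_wsum => o; rewrite /h.
rewrite -/(runmax f m.+1 o).
have Y0 := runmax_ge0 f m o.
have YZ := runmaxS f m o.
have x_le := norm_cexp_le_runmax f m o.
have d_le := norm_mdiff_le f m o.
have -> : cexp m.+1 f o = cexp m f o + mdiff m f o by rewrite /mdiff; ring.
move: (cexp m f o) (mdiff m f o) (runmax f m o) (runmax f m.+1 o) Y0 YZ x_le d_le.
move=> x d y z y0 yz xy dyz.
have main : (x ^+ 2 + 2 * (x * d)) * (y `^ (p - 2) - z `^ (p - 2)) <=
    5 / p * (z `^ p - y `^ p).
  move: y0; rewrite le_eqVlt => /predU1P[y0|y0].
    have x0 : x = 0 by apply/eqP; rewrite -normr_le0 y0.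
    rewrite x0 expr0n/= mul0r mulr0 addr0 mul0r -y0 powR0 ?gt_eqF// subr0.
    by rewrite mulr_ge0 ?powR_ge0 ?divr_ge0// ltW.
  have := @powR_decrement_le R p y z p12; rewrite (ltW y0) yz => /(_ isT) D.
  have W0 : 0 <= y `^ (p - 2) - z `^ (p - 2).
    rewrite subr_ge0 -[p - 2]opprB !powRN lef_pV2 ?posrE ?powR_gt0//; last by lra.
    by apply: ge0_ler_powR; rewrite ?nnegrE; lra.
  have : x ^+ 2 + 2 * (x * d) <= 5 * (y * z).
    have x2 : x ^+ 2 <= y * z.
      rewrite -real_normK ?num_real// expr2; apply: ler_pM => //.
      exact: le_trans yz.
    have : x * d <= y * (y + z).
      apply: le_trans (ler_norm _) _; rewrite normrM; exact: ler_pM.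
    have : y * y <= y * z by rewrite ler_pM2l.
    by lra.
  move=> /(ler_wpM2r W0) /le_trans; apply.
  by lra.
by lra.
Qed.

(* The weak form of the conditional inequality
   [E_{k+1} (\sum_(k <= j < n) (mdiff j b)^2) <= B^2]. *)
Definition bmo_le n (B : R) (b : Om -> R) : Prop :=
  forall k h, (k < n)%N -> adapted k.+1 h -> (forall o, 0 <= h o) ->
    wsum (fun o => h o * \sum_(k <= j < n) mdiff j b o ^+ 2)
    <= wsum (fun o => h o * B ^+ 2).

(** Carleson embedding: [garsia] with the constant majorant [B^2]. *)
Lemma bmo_carleson n (B : R) b (V : nat -> Om -> R) : bmo_le n B b ->
  (forall k, adapted k (V k)) ->
  (forall o, 0 <= V 0%N o) -> (forall k o, V k o <= V k.+1 o) ->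
  \sum_(0 <= k < n) wsum (fun o => mdiff k b o ^+ 2 * V k.+1 o)
    <= B ^+ 2 * wsum (V n).
Proof.
move=> Bb Vad V0 Vmon; rewrite -wsumZ.
apply: (garsia (a := fun k o => mdiff k b o ^+ 2) (Phi := fun=> B ^+ 2)) => // o.
exact: sqr_ge0.
Qed.

(** The condition on [u] is required only where [d] is nonzero: with [s] a negative power of a
    running maximum, [s] takes the value 0 where that maximum vanishes, and the condition may fail
    there. *)
Lemma sum_amgm n (B : R) (a d s t u : nat -> Om -> R) : 0 < B ->
  (forall k o, 0 <= s k o) -> (forall k o, 0 <= t k o) -> (forall k o, 0 <= u k o) ->
  (forall k o, d k o != 0 -> u k o ^+ 2 <= s k o * t k o) ->
  \sum_(0 <= k < n) wsum (fun o => `|a k o| * `|d k o| * u k o) <=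
  (B * (\sum_(0 <= k < n) wsum (fun o => d k o ^+ 2 * s k o)) +
   (\sum_(0 <= k < n) wsum (fun o => a k o ^+ 2 * t k o)) / B) / 2.
Proof.
move=> B0 s0 t0 u0 ust.
apply: (@le_trans _ _ (\sum_(0 <= k < n) wsum (fun o =>
    2^-1 * (B * (d k o ^+ 2 * s k o) + B^-1 * (a k o ^+ 2 * t k o))))).
  apply: ler_sum => k _; apply: ler_wsum => o; rewrite [leRHS]mulrC [B^-1 * _]mulrC.
  have [d0|dN0] := eqVneq (d k o) 0.
    rewrite d0 normr0 mulr0 mul0r expr0n/= !(mul0r, mulr0) add0r.
    by rewrite mulr_ge0// divr_ge0 ?(ltW B0)// mulr_ge0 ?sqr_ge0.
  by apply: amgm_weighted => //; exact: ust.
under eq_bigr do rewrite wsumZ wsumD !wsumZ.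
by rewrite -mulr_sumr big_split/= -!mulr_sumr [leLHS]mulrC [B^-1 * _]mulrC.
Qed.

Lemma sum_mdiff_runmax_le n (p B : R) b F G : 1 < p -> 0 < B -> bmo_le n B b ->
  \sum_(0 <= k < n) wsum (fun o => `|mdiff k b o| * `|mdiff k F o| * runmax G k.+1 o)
  <= 6 * B * (lpsum p (runmax F n) + lpsum (p / (p - 1)) (runmax G n)).
Proof.
move=> p1 B0 Bb; set q := p / (p - 1).
have p0 : 0 < p by lra.
have q0 : 0 < q by rewrite divr_gt0// subr_gt0.
have F0 := lpsum_ge0 p (runmax F n); have G0 := lpsum_ge0 q (runmax G n).
have mono (r : R) f k o : 0 <= r -> runmax f k o `^ r <= runmax f k.+1 o `^ r.
  by move=> r0; apply: ge0_ler_powR => //; rewrite ?nnegrE ?runmax_ge0 ?runmaxS.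
have ada (r : R) f k : adapted k (fun o => runmax f k o `^ r).
  by apply: (adapted1 (fun y : R => y `^ r)); exact: adapted_runmax.
have [p2|p2] := leP p 2.
  have p12 : 1 < p <= 2 by rewrite p1.
  (* By [powR_mixed_le], [V] times the power [p - 2] of the maximum of [F] dominates the square of
     the maximum of [G]. [V] increases, so it can be the weight for the differences of [b]. *)
  pose V k o := runmax F k o `^ p + runmax G k o `^ q.
  apply: le_trans (sum_amgm (s := fun k o => runmax F k.+1 o `^ (p - 2))
    (t := fun k => V k.+1) (d := fun k => mdiff k F)
    (u := fun k => runmax G k.+1) n (fun k => mdiff k b) B0 _ _ _ _) _.
  - by move=> k o; exact: powR_ge0.
  - by move=> k o; rewrite addr_ge0 ?powR_ge0.
  - by move=> k o; exact: runmax_ge0.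
  - move=> k o dN0.
    have Y0 : 0 < runmax F k.+1 o.
      rewrite lt_neqAle runmax_ge0 andbT; apply: contra dN0 => /eqP Y0.
      rewrite -normr_le0; apply: le_trans (norm_mdiff_le _ _ _) _.
      by have := runmaxS F k o; rewrite -Y0; lra.
    have := powR_mixed_le p12 (ltW Y0) (runmax_ge0 G k.+1 o).
    rewrite -/q -/(V k.+1 o) => /(ler_wpM2l (powR_ge0 (runmax F k.+1 o) (p - 2))).
    rewrite mulrA -powRD ?(gt_eqF Y0) ?implybT// (_ : p - 2 + (2 - p) = 0); last by ring.
    by rewrite powRr0 mul1r.
  have H1 := wsum_sqr_mdiff_weight_le F n p12.
  have H2 := @bmo_carleson n B b V Bb.
  have {}H2 : \sum_(0 <= k < n) wsum (fun o => mdiff k b o ^+ 2 * V k.+1 o) <=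
      B ^+ 2 * (lpsum p (runmax F n) + lpsum q (runmax G n)).
    rewrite !lpsum_runmax -wsumD; apply: H2.
    - by move=> k; apply: (adapted2 (fun x y => x + y)).
    - by move=> o; rewrite addr_ge0 ?powR_ge0.
    - by move=> k o; rewrite lerD ?mono// ltW.
  have {}H2 : (\sum_(0 <= k < n) wsum (fun o => mdiff k b o ^+ 2 * V k.+1 o)) / B <=
      B * (lpsum p (runmax F n) + lpsum q (runmax G n)).
    by rewrite ler_pdivrMr// mulrAC -expr2.
  move/(ler_wpM2l (ltW B0)) : H1.
  have := mulr_ge0 (ltW B0) F0; have := mulr_ge0 (ltW B0) G0; lra.
have q1 : 1 < q <= 2.
  by rewrite /q ltr_pdivlMr ?ler_pdivrMr ?subr_gt0//; lra.
(* Here [q <= 2], and the square of the maximum of [G] splits exactly into the powers [2 - q] and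
   [q], both increasing, so [garsia] handles both sums. *)
apply: le_trans (sum_amgm (s := fun k o => runmax G k.+1 o `^ (2 - q))
  (t := fun k o => runmax G k.+1 o `^ q)
  (d := fun k => mdiff k F) (u := fun k => runmax G k.+1) n (fun k => mdiff k b) B0 _ _ _ _) _.
- by move=> k o; exact: powR_ge0.
- by move=> k o; exact: powR_ge0.
- by move=> k o; exact: runmax_ge0.
- move=> k o _; rewrite -powRD; first by rewrite -powR_mulrn ?runmax_ge0// subrK.
  by apply/implyP; rewrite subrK pnatr_eq0.
have H2 : (\sum_(0 <= k < n) wsum (fun o => mdiff k b o ^+ 2 * runmax G k.+1 o `^ q)) / B
    <= B * lpsum q (runmax G n).
  rewrite ler_pdivrMr// mulrAC -expr2 lpsum_runmax.
  apply: (bmo_carleson (V := fun k o => runmax G k o `^ q)) => //.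
  - by move=> o; exact: powR_ge0.
  - by move=> k o; rewrite mono// ltW.
(* The mixed product left by [garsia] is separated by [powR_mixed_le] for the exponent [q], whose
   conjugate is [p]. *)
have H1 : \sum_(0 <= k < n) wsum (fun o => mdiff k F o ^+ 2 * runmax G k.+1 o `^ (2 - q))
    <= 5 * (lpsum p (runmax F n) + lpsum q (runmax G n)).
  apply: (@le_trans _ _ (wsum (fun o => 5 * runmax F n o ^+ 2 * runmax G n o `^ (2 - q)))).
    apply: (garsia (a := fun k o => mdiff k F o ^+ 2)
      (V := fun k o => runmax G k o `^ (2 - q))) => //.
    - by move=> o; exact: powR_ge0.
    - by move=> k o; rewrite mono// subr_ge0; case/andP: q1.
    - by move=> o; rewrite mulr_ge0// sqr_ge0.
    - by move=> k h kn hk h0; exact: wsum_sqr_tailS.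
  rewrite !lpsum_runmax -wsumD -wsumZ; apply: ler_wsum => o.
  have := powR_mixed_le q1 (runmax_ge0 G n o) (runmax_ge0 F n o).
  rewrite (conjugate_exponentK p1).
  by lra.
move/(ler_wpM2l (ltW B0)) : H1.
have := mulr_ge0 (ltW B0) F0; have := mulr_ge0 (ltW B0) G0; lra.
Qed.

(** * The paraproduct form *)

Definition paraproduct_form n b F G : R :=
  \sum_(0 <= k < n) wsum (fun o => mdiff k b o *
    (cexp k.+1 F o * cexp k.+1 G o - cexp k F o * cexp k G o)).

(** The bracket adds Doob's constants for [p] and its conjugate; 12 is twice the 6 of
    [sum_mdiff_runmax_le], which is applied in both orders of [F] and [G]. *)
Definition paraproduct_const (p : R) : R :=
  12 * (2 `^ p / (p - 1) + 2 `^ (p / (p - 1)) / (p / (p - 1) - 1)).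

Lemma paraproduct_const_ge0 p : 1 < p -> 0 <= paraproduct_const p.
Proof.
move=> p1; have q1 : 1 < p / (p - 1) := conjugate_exponent_gt1 p1.
by rewrite mulr_ge0// addr_ge0// divr_ge0 ?powR_ge0//; lra.
Qed.

Lemma paraproduct_form_le n (p B : R) b F G : 1 < p -> 0 < B -> bmo_le n B b ->
  lpsum p F <= 1 -> lpsum (p / (p - 1)) G <= 1 ->
  `|paraproduct_form n b F G| <= paraproduct_const p * B.
Proof.
move=> p1 B0 Bb F1 G1; set q := p / (p - 1) in G1 *.
have q1 : 1 < q := conjugate_exponent_gt1 p1.
have qp : q / (q - 1) = p.
  exact: conjugate_exponentK.
have HF := sum_mdiff_runmax_le F G p1 B0 Bb.
have HG := sum_mdiff_runmax_le G F q1 B0 Bb.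
rewrite qp in HG; rewrite -/q in HF.
apply: (@le_trans _ _
  (\sum_(0 <= k < n) wsum (fun o => `|mdiff k b o| * `|mdiff k F o| * runmax G k.+1 o) +
   \sum_(0 <= k < n) wsum (fun o => `|mdiff k b o| * `|mdiff k G o| * runmax F k.+1 o))).
  rewrite -big_split/=; apply: le_trans (ler_norm_sum _ _ _) _; apply: ler_sum => k _.
  apply: le_trans (ler_norm_wsum _) _; rewrite -wsumD; apply: ler_wsum => o.
  rewrite normrM -[X in _ <= X + _]mulrA -[X in _ <= _ + X]mulrA -mulrDr; apply: ler_wpM2l => //.
  rewrite (_ : _ - _ = mdiff k F o * cexp k.+1 G o + mdiff k G o * cexp k F o); last first.
    by rewrite /mdiff; ring.
  apply: le_trans (ler_normD _ _) _; rewrite !(normrM (mdiff _ _ _)).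
  apply: lerD; apply: ler_wpM2l => //; first exact: (norm_cexp_le_runmax G k.+1 o).
  exact: le_trans (norm_cexp_le_runmax F k o) (runmaxS F k o).
have DF : lpsum p (runmax F n) <= 2 `^ p / (p - 1).
  apply: le_trans (doob _ _ p1) _; rewrite -[leRHS]mulr1; apply: ler_wpM2l => //.
  by rewrite divr_ge0 ?powR_ge0//; lra.
have DG : lpsum q (runmax G n) <= 2 `^ q / (q - 1).
  apply: le_trans (doob _ _ q1) _; rewrite -[leRHS]mulr1; apply: ler_wpM2l => //.
  by rewrite divr_ge0 ?powR_ge0//; lra.
apply: le_trans (lerD HF HG) _.
rewrite /paraproduct_const -/q.
have /(ler_wpM2l (ltW B0)) := lerD DF DG.
by lra.
Qed.

(** * Norms, duality and the commutator on a finite space *)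

Definition lpnorm (p : R) f : R := lpsum p f `^ p^-1.

Lemma lpnormE p f : lpnorm p f = lpsum p f `^ p^-1.
Proof. by []. Qed.

(* Keeps failing unification attempts from unfolding the real power. *)
Opaque lpnorm lpsum.

Lemma lpnorm_ge0 p f : 0 <= lpnorm p f.
Proof. by rewrite lpnormE powR_ge0. Qed.

Lemma lpsumZ (p a : R) f : lpsum p (fun o => a * f o) = `|a| `^ p * lpsum p f.
Proof. by rewrite !lpsumE -wsumZ; apply: eq_wsum => o; rewrite normrM powRM. Qed.

Lemma lpsum_le (p : R) f g : 0 <= p -> (forall o, `|f o| <= `|g o|) ->
  lpsum p f <= lpsum p g.
Proof.
by move=> p0 fg; rewrite !lpsumE; apply: ler_wsum => o; apply: ge0_ler_powR; rewrite ?nnegrE.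
Qed.

Lemma lpnormK (p : R) f : p != 0 -> lpnorm p f `^ p = lpsum p f.
Proof. by move=> p0; rewrite lpnormE -powRrM mulVf// powRr1// lpsum_ge0. Qed.

Lemma lpnorm_eq0 (p : R) f o : p != 0 -> lpnorm p f = 0 -> f o = 0.
Proof.
move=> p0; rewrite lpnormE => /powR_eq0_eq0/eqP; rewrite lpsumE psumr_eq0; last first.
  by move=> i _; rewrite mulr_ge0 ?powR_ge0 ?(ltW (w_gt0 _)).
move=> /allP/(_ o (mem_index_enum _))/=.
by rewrite mulf_eq0 gt_eqF//= powR_eq0 p0 andbT normr_eq0 => /eqP.
Qed.

(** The weighted inequalities end in a sum of a p-th and a q-th power sum; rescaling to unit norms
    turns this into a product of norms. A vanishing norm forces a zero function, where scaling by 0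
    replaces division. *)
Lemma lpnorm_homogeneous_le (p q C : R) (Q : (Om -> R) -> (Om -> R) -> R) F G :
  0 < p -> 0 < q ->
  (forall a c F G, Q (fun o => a * F o) (fun o => c * G o) = a * c * Q F G) ->
  (forall F G, lpsum p F <= 1 -> lpsum q G <= 1 -> `|Q F G| <= C) ->
  `|Q F G| <= C * lpnorm p F * lpnorm q G.
Proof.
move=> p0 q0 QZ QC.
have [F0|FN0] := eqVneq (lpnorm p F) 0.
  have -> : Q F G = Q (fun o => 0 * F o) (fun o => 1 * G o).
    congr Q; apply/funext => o; rewrite ?mul1r//.
    by rewrite mul0r (lpnorm_eq0 _ _ F0)// gt_eqF.
  by rewrite QZ [0 * 1]mul0r mul0r normr0 F0 mulr0 mul0r.
have [G0|GN0] := eqVneq (lpnorm q G) 0.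
  have -> : Q F G = Q (fun o => 1 * F o) (fun o => 0 * G o).
    congr Q; apply/funext => o; rewrite ?mul1r//.
    by rewrite mul0r (lpnorm_eq0 _ _ G0)// gt_eqF.
  by rewrite QZ mulr0 mul0r normr0 G0 mulr0.
have unit (r : R) f : 0 < r -> lpnorm r f != 0 ->
    lpsum r (fun o => (lpnorm r f)^-1 * f o) <= 1.
  move=> r0 fN0; rewrite lpsumZ -(@lpnormK r f) ?gt_eqF// -powRM ?lpnorm_ge0//.
  by rewrite ger0_norm ?invr_ge0 ?lpnorm_ge0// mulVf// powR1.
have scale (a c : R) : a != 0 -> c != 0 ->
    Q F G = a * c * Q (fun o => a^-1 * F o) (fun o => c^-1 * G o).
  move=> a0 c0; rewrite -QZ; congr Q; apply/funext => o; exact/esym/mulVKf.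
rewrite (scale _ _ FN0 GN0).
have bound (u a c : R) : 0 <= a -> 0 <= c -> `|u| <= C -> `|a * c * u| <= C * a * c.
  move=> a0 c0 uC; rewrite normrM ger0_norm ?mulr_ge0// mulrC -[leRHS]mulrA.
  by rewrite ler_wpM2r// mulr_ge0.
apply: bound (lpnorm_ge0 p F) (lpnorm_ge0 q G) _.
exact: QC (unit p F p0 FN0) (unit q G q0 GN0).
Qed.

Lemma holder_wsum (p : R) F G : 1 < p ->
  `|wsum (fun o => F o * G o)| <= lpnorm p F * lpnorm (p / (p - 1)) G.
Proof.
move=> p1; have q1 := conjugate_exponent_gt1 p1; set q := p / (p - 1) in q1 *.
have p0 : 0 < p by lra. have q0 : 0 < q by lra.
rewrite -[lpnorm p F]mul1r.
apply: (lpnorm_homogeneous_le (Q := fun F G => wsum (fun o => F o * G o))) => //.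
  by move=> a c f g; rewrite -wsumZ; apply: eq_wsum => o; ring.
move=> f g f1 g1; apply: le_trans (ler_norm_wsum _) _.
have pq : p^-1 + q^-1 = 1 by rewrite /q; field; rewrite !gt_eqF ?subr_gt0.
apply: (@le_trans _ _ (p^-1 * lpsum p f + q^-1 * lpsum q g)).
  rewrite !lpsumE -!wsumZ -wsumD; apply: ler_wsum => o.
  rewrite normrM [p^-1 * _]mulrC [q^-1 * _]mulrC.
  by apply: conjugate_powR => //; exact: normr_ge0.
by rewrite -pq; apply: lerD; rewrite -[leRHS]mulr1 ler_wpM2l// invr_ge0 ltW.
Qed.

Lemma paraproduct_form_lpnorm_le n (p B : R) b F G : 1 < p -> 0 < B -> bmo_le n B b ->
  `|paraproduct_form n b F G| <=
  paraproduct_const p * B * lpnorm p F * lpnorm (p / (p - 1)) G.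
Proof.
move=> p1 B0 Bb; have q1 := conjugate_exponent_gt1 p1.
apply: lpnorm_homogeneous_le; [lra|lra| |].
  move=> a c f g; rewrite /paraproduct_form mulr_sumr.
  apply: eq_bigr => k _; rewrite -wsumZ; apply: eq_wsum => o.
  by rewrite !cexpZ; ring.
by move=> f g; exact: paraproduct_form_le.
Qed.

(** The product of the three martingales is telescoped. Of the seven terms of an increment, the
    three with a single difference have mean zero, the remaining three with a difference of [b] form
    the paraproduct, and the last is diagonal with weight [cexp k b]. *)
Lemma wsum_mul3 m b F G :
  wsum (fun o => cexp m b o * (cexp m F o * cexp m G o)) =
  wsum (fun o => cexp 0 b o * (cexp 0 F o * cexp 0 G o)) +
  paraproduct_form m b F G +
  \sum_(0 <= k < m) wsum (fun o => cexp k b o * (mdiff k F o * mdiff k G o)).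
Proof.
elim: m => [|m IH].
  by rewrite /paraproduct_form !big_geq// !addr0.
rewrite /paraproduct_form !big_nat_recr//= -/(paraproduct_form m b F G).
have reassoc (a c x y z : R) : a + (c + x) + (y + z) = (a + c + y) + (x + z) by ring.
rewrite reassoc -IH.
have Z f g h : wsum (fun o => (cexp m g o * cexp m h o) * mdiff m f o) = 0.
  apply: wsum_mdiff; apply: (adapted2 (fun x y => x * y)); exact: adapted_cexp.
rewrite -[RHS]addr0 -(Z b F G) -[RHS]addr0 -(Z F b G) -[RHS]addr0 -(Z G b F).
by rewrite -!wsumD; apply: eq_wsum => o; rewrite /mdiff; ring.
Qed.

(** A function minus its coarsest average is at most twice its running maximum, so Doob's constant
    enters, under a p-th root. *)
Definition centering_const (p : R) : R := (2 `^ p * (2 `^ p / (p - 1))) `^ p^-1.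

Lemma lpnorm_centered_le n (p : R) F : injective (key n) -> 1 < p ->
  lpnorm p (fun o => F o - cexp 0 F o) <= centering_const p * lpnorm p F.
Proof.
move=> key_inj p1; have p0 : 0 < p by lra.
have p10 : 0 <= 2 `^ p / (p - 1) by rewrite divr_ge0 ?powR_ge0//; lra.
have c0 : 0 <= 2 `^ p * (2 `^ p / (p - 1)) by rewrite mulr_ge0 ?powR_ge0.
rewrite !lpnormE /centering_const -powRM ?lpsum_ge0//.
apply: ge0_ler_powR; rewrite ?nnegrE ?lpsum_ge0//.
- by rewrite invr_ge0 ltW.
- by rewrite mulr_ge0 ?lpsum_ge0.
rewrite -mulrA; apply: le_trans (ler_wpM2l (powR_ge0 _ _) (doob F n p1)).
rewrite -[2 in leRHS]ger0_norm// -lpsumZ; apply: lpsum_le; first exact: ltW.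
move=> o; rewrite [leRHS]ger0_norm ?mulr_ge0 ?runmax_ge0//.
apply: le_trans (ler_normB _ _) _; rewrite mulr2n mulrDl mul1r; apply: lerD.
  rewrite -[F o](cexp_adapted (k := n)) ?norm_cexp_le_runmax//.
  by move=> i j /key_inj ->.
by apply: le_trans (norm_cexp_le_runmax _ 0 _) _; exact: runmax_le.
Qed.

(** For [r = q - 1], applied to a function, this gives the extremal partner of that function in
    Hölder's inequality. *)
Definition signed_powR (r x : R) : R := Num.sg x * `|x| `^ r.

(** The adjoint relation is assumed level by level, with a weight [h] of the same level: for
    [h = cexp k b] it is the cancellation of the diagonal terms. The factor 2 counts the two
    remaining paraproducts. *)
Lemma wsum_commutator_le n (p B N : R) b (T Ts : (Om -> R) -> Om -> R) F G :
  injective (key n) -> 1 < p -> 0 < B -> 0 <= N -> bmo_le n B b ->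
  (forall F o, cexp 0 (T F) o = 0) -> (forall G o, cexp 0 (Ts G) o = 0) ->
  (forall k h F G, (k < n)%N -> adapted k h ->
    wsum (fun o => h o * (mdiff k (T F) o * mdiff k G o)) =
    wsum (fun o => h o * (mdiff k F o * mdiff k (Ts G) o))) ->
  (forall F, T (fun o => F o - cexp 0 F o) = T F) ->
  (forall F, (forall o, cexp 0 F o = 0) -> lpnorm p (T F) <= N * lpnorm p F) ->
  `|wsum (fun o => b o * (T F o * G o)) - wsum (fun o => b o * (F o * Ts G o))| <=
  2 * paraproduct_const p * centering_const p * N * B *
  lpnorm p F * lpnorm (p / (p - 1)) G.
Proof.
move=> key_inj p1 B0 N0 Bb T0 Ts0 Tadj Tc Tb.
have cexpn f : cexp n f = f.
  by apply/funext => o; apply: cexp_adapted => i j /key_inj ->.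
have q1 := conjugate_exponent_gt1 p1; set q := p / (p - 1) in q1 *.
set K := centering_const p; have K0 : 0 <= K by exact: powR_ge0.
have p0 : 0 < p by lra. have q0 : 0 < q by lra.
have TK f : lpnorm p (T f) <= N * (K * lpnorm p f).
  rewrite -Tc; apply: le_trans (Tb _ _) _.
    move=> o; rewrite cexpB (cexp_adapted (adapted_cexp (k := 0) f)) subrr//.
  by apply: ler_wpM2l => //; exact: (@lpnorm_centered_le n).
(* For the constant 1 the paraproduct vanishes and [wsum_mul3] becomes Parseval's identity, so
   adjointness of the differences yields adjointness of the operators. *)
have dual f g : wsum (fun o => f o * Ts g o) = wsum (fun o => T f o * g o).
  have P1 f1 f2 : paraproduct_form n (fun=> 1) f1 f2 = 0.
    rewrite /paraproduct_form big1// => k _; rewrite (eq_wsum (g := fun o => 0 * 0)).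
      by rewrite wsumZ mul0r.
    by move=> o; rewrite /mdiff !(cexp_adapted (f := fun=> 1))// subrr !mul0r.
  have mul2 f1 f2 : wsum (fun o => f1 o * f2 o) =
      wsum (fun o => cexp 0 (fun=> 1) o * (cexp 0 f1 o * cexp 0 f2 o)) +
      \sum_(0 <= k < n) wsum (fun o => cexp k (fun=> 1) o * (mdiff k f1 o * mdiff k f2 o)).
    have := wsum_mul3 n (fun=> 1) f1 f2; rewrite P1 addr0 => <-.
    by apply: eq_wsum => o; rewrite !cexpn mul1r.
  rewrite (mul2 f) (mul2 (T f)); congr (_ + _).
    by apply: eq_wsum => o; rewrite T0 Ts0 mulr0 mul0r.
  rewrite !big_nat; apply: eq_bigr => k /andP[_ kn]; symmetry; apply: Tadj => //.
  exact: adapted_cexp.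
(* Testing [Ts g] against its signed power gives its power sum exactly; the norm of the test
   function is then cancelled, which requires the case of a zero power sum to be set aside. *)
have TsK g : lpnorm q (Ts g) <= N * (K * lpnorm q g).
  set g' := Ts g; pose f o := signed_powR (q - 1) (g' o).
  have [g'0|g'N0] := eqVneq (lpsum q g') 0.
    rewrite lpnormE g'0 powR0 ?mulr_ge0 ?powR_ge0// invr_eq0 gt_eqF//.
  have fg' : wsum (fun o => f o * g' o) = lpsum q g'.
    rewrite lpsumE; apply: eq_wsum => o; rewrite /f /signed_powR mulrAC -normrEsg mulr_powRB1//.
  have lpf : lpsum p f = lpsum q g'.
    rewrite !lpsumE; apply: eq_wsum => o; rewrite /f /signed_powR normrM normr_sg.
    have [->|gN0] := eqVneq (g' o) 0.
      by rewrite normr0 mul0r !powR0 ?gt_eqF.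
    rewrite mul1r (ger0_norm (powR_ge0 _ _)) -powRrM; congr (_ `^ _).
    by rewrite /q; field; rewrite gt_eqF ?subr_gt0.
  have : lpsum q g' <= N * (K * lpnorm q g) * lpsum q g' `^ p^-1.
    rewrite -{1}fg' dual; apply: le_trans (ler_norm _) _.
    apply: le_trans (holder_wsum _ _ p1) _; rewrite -/q.
    apply: le_trans (ler_wpM2r (lpnorm_ge0 _ _) (TK f)) _.
    by rewrite [lpnorm p f]lpnormE lpf; lra.
  have Lp : 0 < lpsum q g' `^ p^-1.
    by rewrite powR_gt0// lt_neqAle eq_sym g'N0 lpsum_ge0.
  have {1}<- : lpnorm q g' * lpsum q g' `^ p^-1 = lpsum q g'.
    rewrite lpnormE -powRD ?g'N0 ?implybT// (_ : q^-1 + p^-1 = 1) ?powRr1 ?lpsum_ge0//.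
    by rewrite /q; field; rewrite !gt_eqF ?subr_gt0.
  by rewrite ler_pM2r.
have := wsum_mul3 n b (T F) G; have := wsum_mul3 n b F (Ts G).
rewrite !cexpn => -> ->.
have -> : \sum_(0 <= k < n) wsum (fun o => cexp k b o * (mdiff k (T F) o * mdiff k G o)) =
    \sum_(0 <= k < n) wsum (fun o => cexp k b o * (mdiff k F o * mdiff k (Ts G) o)).
  rewrite !big_nat; apply: eq_bigr => k /andP[_ kn]; apply: Tadj => //.
  exact: adapted_cexp.
rewrite (eq_wsum (f := fun o => cexp 0 b o * (cexp 0 (T F) o * cexp 0 G o))
  (g := fun o => 0 * 0)); last by move=> o; rewrite T0 !(mul0r, mulr0).
rewrite (eq_wsum (f := fun o => cexp 0 b o * (cexp 0 F o * cexp 0 (Ts G) o))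
  (g := fun o => 0 * 0)); last by move=> o; rewrite Ts0 !(mul0r, mulr0).
rewrite wsumZ mul0r !add0r opprD addrACA subrr addr0.
apply: le_trans (ler_normB _ _) _.
apply: le_trans (lerD (paraproduct_form_lpnorm_le (T F) G p1 B0 Bb)
  (paraproduct_form_lpnorm_le F (Ts G) p1 B0 Bb)) _.
rewrite -/q; set P := paraproduct_const p.
have PB : 0 <= P * B by rewrite mulr_ge0 ?paraproduct_const_ge0// ltW.
have := ler_wpM2l PB (ler_wpM2r (lpnorm_ge0 q G) (TK F)).
have := ler_wpM2l PB (ler_wpM2l (lpnorm_ge0 p F) (TsK G)).
clearbody P K; move: (lpnorm p (T F)) (lpnorm q G) (lpnorm p F) (lpnorm q (Ts G)).
clear; move=> x y z t; lra.
Qed.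

Lemma eq_cexp_block k f g o :
  (forall o', key k o' = key k o -> f o' = g o') -> cexp k f o = cexp k g o.
Proof.
by move=> fg; congr (_ / _); apply: eq_bigr => o' /eqP/fg ->.
Qed.

Lemma cexp_tower j k f o : (j <= k)%N -> cexp j (cexp k f) o = cexp j f o.
Proof.
move=> jk; pose h o' : R := (key j o' == key j o)%:R.
have hk : adapted k h by apply: adapted_le jk _ => i i' e; rewrite /h e.
have E f' : \sum_(o' | key j o' == key j o) w o' * f' o' = wsum (fun o => h o * f' o).
  rewrite big_mkcond; apply: eq_bigr => i _; rewrite /h.
  by case: ifP => _; rewrite ?mul1r ?mul0r ?mulr0.
by rewrite {1}/cexp E wsum_cexpr// -E.
Qed.

Lemma cexp_mdiff k f o : cexp k (mdiff k f) o = 0.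
Proof.
by rewrite cexpB cexp_tower// (cexp_adapted (adapted_cexp (k := k) f)) subrr.
Qed.

Lemma cexp_sum (I : Type) (r : seq I) (P : pred I) (u : I -> Om -> R) k o :
  cexp k (fun o => \sum_(i <- r | P i) u i o) o = \sum_(i <- r | P i) cexp k (u i) o.
Proof.
rewrite /cexp -mulr_suml exchange_big; congr (_ / _).
by apply: eq_bigr => o' _; rewrite mulr_sumr.
Qed.

(** * Functions assembled from prescribed martingale differences *)

Section DifferenceSequence.
Context (u : nat -> Om -> R).
Context (u_adapted : forall k, adapted k.+1 (u k)).
Context (cexp_u : forall k o, cexp k (u k) o = 0).

Lemma cexp_diff_sequence m i o :
  cexp i (fun o => \sum_(0 <= k < m) u k o) o =
  \sum_(0 <= k < m) if (k < i)%N then u k o else 0.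
Proof.
rewrite cexp_sum; apply: eq_bigr => k _; case: ltnP => ik.
  by rewrite cexp_adapted//; exact: adapted_le ik (@u_adapted k).
by rewrite -(cexp_tower _ _ ik) (eq_cexp i (g := fun=> 0)) ?cexp_adapted//.
Qed.

Lemma mdiff_diff_sequence m j o : (j < m)%N ->
  mdiff j (fun o => \sum_(0 <= k < m) u k o) o = u j o.
Proof.
move=> jm; rewrite /mdiff !cexp_diff_sequence -sumrB.
rewrite big_mkord (bigD1 (Ordinal jm))//= ltnS leqnn ltnn subr0 big1 ?addr0//.
move=> i ij; rewrite ltnS leq_eqVlt (negbTE (_ : val i != j)) ?subrr//.
Qed.

Lemma cexp0_diff_sequence m o : cexp 0 (fun o => \sum_(0 <= k < m) u k o) o = 0.
Proof. by rewrite cexp_diff_sequence big1. Qed.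

End DifferenceSequence.

End FiniteMartingales.

(** * Lattice geometry *)

Section LatticeGeometry.
Context {R : realType} {X : set R} (L : lattice X).
Implicit Types (I J : set R) (f g : R -> R) (k m : int).
Local Notation mu := (@lebesgue_measure R).

Lemma gen_measurable k I : L k I -> measurable (I : set (measurableTypeR R)).
Proof. by move=> /gen_itv[a [b [_ ->]]]; exact: measurable_itv. Qed.

Lemma gen_neq0 k I : L k I -> I !=set0.
Proof.
by move=> /gen_itv[a [b [ab ->]]]; exists a; rewrite /= in_itv/= lexx.
Qed.

Lemma gen_measure k I : L k I -> exists2 r : R, 0 < r & mu I = r%:E.
Proof.
move=> /gen_itv[a [b [ab ->]]]; exists (b - a); first by rewrite subr_gt0.
by rewrite lebesgue_measure_itv/= lte_fin ab.
Qed.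

Lemma gen_measure_gt0 k I : L k I -> 0 < fine (mu I).
Proof. by move=> /gen_measure[r r0 ->]. Qed.

Lemma gen_measure_lty k I : L k I -> (mu I < +oo)%E.
Proof. by move=> /gen_measure[r _ ->]; exact: ltry. Qed.

Lemma gen_subX k I : L k I -> I `<=` X.
Proof.
move=> LI x Ix; have : (\bigcup_(I in L k) I) x by exists I.
by rewrite gen_cover.
Qed.

Lemma gen_eq k I J x : L k I -> L k J -> I x -> J x -> I = J.
Proof. by move=> LI LJ Ix Jx; apply: gen_disj LI LJ _; exists x. Qed.

Definition cell k x : set R := xget set0 [set I | L k I /\ I x].

Lemma cellP k x : X x -> L k (cell k x) /\ cell k x x.
Proof.
move=> Xx; have [I LI Ix] : (\bigcup_(I in L k) I) x by rewrite gen_cover.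
by rewrite /cell; case: xgetP => [J _ //|/(_ I)]; case.
Qed.

Lemma cell_gen k x : X x -> L k (cell k x).
Proof. by move=> /(cellP k)[]. Qed.

Lemma mem_cell k x : X x -> cell k x x.
Proof. by move=> /(cellP k)[]. Qed.

Lemma cell_eq k I x : L k I -> I x -> cell k x = I.
Proof.
move=> LI Ix; have Xx := gen_subX LI Ix.
exact: gen_eq (cell_gen k Xx) LI (mem_cell k Xx) Ix.
Qed.

Lemma cellS k x : X x -> cell (k + 1) x `<=` cell k x.
Proof.
move=> Xx; have [F [_ FL e]] := gen_refine (cell_gen k Xx).
have : cell k x x by exact: mem_cell.
rewrite {1}e => -[J FJ Jx] y Jy; rewrite e; exists J => //.
by rewrite -(cell_eq (FL _ FJ) Jx).
Qed.

Lemma cell_le k (j : nat) x : X x -> cell (k + j%:Z) x `<=` cell k x.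
Proof.
move=> Xx; elim: j => [|j IH]; first by rewrite addr0.
by rewrite -addn1 PoszD addrA => y /(cellS Xx)/IH.
Qed.

Lemma cell_anti k m x : X x -> k <= m -> cell m x `<=` cell k x.
Proof.
move=> Xx km; have -> : m = k + (`|m - k|%N)%:Z.
  by rewrite gez0_abs ?subr_ge0// subrKC.
exact: cell_le.
Qed.

Lemma gen_nested k m I J x : k <= m -> L k I -> L m J -> I x -> J x -> J `<=` I.
Proof.
move=> km LI LJ Ix Jx; rewrite -(cell_eq LI Ix) -(cell_eq LJ Jx).
exact: cell_anti (gen_subX LI Ix) km.
Qed.

(** Each refinement is finite, so finitely many steps stay finite. This is what makes the windows
    finite. *)
Lemma gen_finite k (j : nat) I : L k I ->
  finite_set [set J | L (k + j%:Z) J /\ J `<=` I].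
Proof.
elim: j I k => [|j IH] I k LI.
  apply: (sub_finite_set _ (finite_set1 I)) => J [LJ JI] /=.
  rewrite addr0 in LJ; have [x Jx] := gen_neq0 LJ.
  by apply: gen_eq LJ LI Jx (JI _ Jx).
have [F [Ffin FL IF]] := gen_refine LI.
have : finite_set (\bigcup_(K in F) [set J | L (k + 1 + j%:Z) J /\ J `<=` K]).
  by apply: bigcup_finite => // K FK; apply: IH; exact: FL.
apply: sub_finite_set => J [LJ JI] /=.
have e : k + j.+1%:Z = k + 1 + j%:Z by rewrite -addrA -PoszD add1n.
rewrite e in LJ; have [x Jx] := gen_neq0 LJ.
have := JI _ Jx; rewrite IF => -[K FK Kx]; exists K => //; split => //.
by apply: gen_nested (FL _ FK) LJ Kx Jx; rewrite lerDl.
Qed.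

Lemma is_rank_gen I k : is_rank L I k -> L k I.
Proof. by case. Qed.

Lemma is_rank_uniq I k m : is_rank L I k -> is_rank L I m -> k = m.
Proof.
by move=> [Lk hk] [Lm hm]; apply/le_anti; rewrite hk// hm.
Qed.

(** The cells of a point decrease, so an interval that reappears in a later generation belongs to
    all generations in between. A single step therefore decides the rank. *)
Lemma is_rankP k I : L k I -> is_rank L I k <-> ~ L (k + 1) I.
Proof.
move=> LI; split; first by move=> [_ h] /h; rewrite leNgt ltrDl.
move=> nL; split=> // m Lm; rewrite leNgt; apply/negP => km; apply: nL.
have [x Ix] := gen_neq0 LI; have Xx := gen_subX LI Ix.
have km1 : k + 1 <= m by rewrite lezD1.
rewrite (_ : I = cell (k + 1) x); first exact: cell_gen.
apply/seteqP; split; last by rewrite -(cell_eq LI Ix); exact: cellS.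
by rewrite -{1}(cell_eq Lm Ix); exact: cell_anti.
Qed.

Lemma childP I k : is_rank L I k -> child L I = [set J | L (k + 1) J /\ J `<=` I].
Proof.
move=> rk; apply/seteqP; split => J; last by move=> [LJ JI]; exists k.
by move=> [m [rm LJ JI]]; rewrite (is_rank_uniq rk rm).
Qed.

Lemma child_rank I : child L I !=set0 -> exists k, is_rank L I k.
Proof. by move=> [J [k [rk _ _]]]; exists k. Qed.

Lemma child_nonempty I k : is_rank L I k -> child L I !=set0.
Proof.
move=> rk; rewrite (childP rk); have LI := is_rank_gen rk.
have [x Ix] := gen_neq0 LI; have Xx := gen_subX LI Ix.
exists (cell (k + 1) x); split; first exact: cell_gen.
by rewrite -(cell_eq LI Ix); exact: cellS.
Qed.

Lemma Delta_no_rank I f : ~ (exists k, is_rank L I k) -> Delta L I f = cst 0.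
Proof.
move=> nrk; apply/funext => x; rewrite /Delta asboolF//.
by move=> /child_rank.
Qed.

Lemma Delta_notin I f x : ~ I x -> Delta L I f x = 0.
Proof.
move=> nIx; rewrite /Delta; case: asboolP => // _.
rewrite /Expect indicE memNset// mulr0 subr0 fsbig1// => J [k [_ _ JI]].
by rewrite /Expect indicE memNset ?mulr0// => /JI.
Qed.

Lemma Delta_rank I k f x : is_rank L I k -> I x ->
  Delta L I f x = avg (cell (k + 1) x) f - avg I f.
Proof.
move=> rk Ix; have LI := is_rank_gen rk; have Xx := gen_subX LI Ix.
rewrite /Delta asboolT; last exact: child_nonempty rk.
congr (_ - _); last by rewrite /Expect indicE mem_set ?mulr1.
rewrite -[LHS](fsbig_widen [set cell (k + 1) x])/=.
- by rewrite fsbig_set1 /Expect indicE mem_set ?mulr1//; exact: mem_cell.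
- move=> _ ->; rewrite (childP rk); split; first exact: cell_gen.
  by rewrite -(cell_eq LI Ix); exact: cellS.
- move=> J [+ /= nJ]; rewrite (childP rk) => -[LJ JI].
  by rewrite /Expect indicE memNset ?mulr0// => Jx; apply: nJ; rewrite (cell_eq LJ Jx).
Qed.

(** If the ranks satisfied [k1 < k2], then [J], of generation [k1 + 1], would contain the second
    parent and so equal it. That parent would then belong to generation [k2 + 1], beyond its
    rank. *)
Lemma parent_unique I1 I2 J : child L I1 J -> child L I2 J -> I1 = I2.
Proof.
have lt_case k1 k2 K1 K2 : is_rank L K1 k1 -> is_rank L K2 k2 ->
    L (k1 + 1) J -> L (k2 + 1) J -> J `<=` K1 -> J `<=` K2 -> k1 < k2 -> False.
  move=> r1 r2 L1 L2 J1 J2; rewrite -lezD1 => k12.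
  have [x Jx] := gen_neq0 L1.
  have K2J : K2 `<=` J by exact: gen_nested k12 L1 (is_rank_gen r2) Jx (J2 _ Jx).
  have eJ : K2 = J by apply/seteqP; split.
  by move/(is_rankP (is_rank_gen r2)) : r2; apply; rewrite eJ.
move=> [k1 [r1 L1 J1]] [k2 [r2 L2 J2]].
have [k12|k21|e] := ltgtP k1 k2.
- by case: (lt_case _ _ _ _ r1 r2).
- by case: (lt_case _ _ _ _ r2 r1).
- have [x Jx] := gen_neq0 L1; rewrite -e in r2.
  exact: gen_eq (is_rank_gen r1) (is_rank_gen r2) (J1 _ Jx) (J2 _ Jx).
Qed.

Lemma jump_child (u : set R -> R -> R) I J (c : R) : child L I J ->
  (forall x, J x -> u I x = c) -> jump L u J = c.
Proof.
move=> IJ uc; rewrite /jump asboolT; last by exists I.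
have -> : xget set0 [set I' | child L I' J] = I.
  case: xgetP => [I' _ /= I'J|/(_ I)]; last by [].
  exact: parent_unique I'J IJ.
have [k [_ LJ _]] := IJ; have [x Jx] := gen_neq0 LJ.
by apply: uc; case: xgetP => [y _ //|/(_ x)].
Qed.

Lemma BMO_norm_ge (u : set R -> R -> R) (B : R) k J : L k J ->
  (BMO_norm L u <= B%:E)%E -> 0 <= B ->
  (\esum_(I in [set I | mem_lattice L I /\ I `<=` J])
     (`|jump L u I| ^+ 2 * fine (mu I))%:E <= (B ^+ 2 * fine (mu J))%:E)%E.
Proof.
move=> LJ uB B0; have muJ := gen_measure_gt0 LJ.
set y := esum _ _.
have y0 : (0 <= y)%E.
  apply: esum_ge0 => I [[m _ LI] _]; rewrite lee_fin mulr_ge0 ?exprn_ge0//.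
  exact/ltW/gen_measure_gt0/LI.
have : ((((fine (mu J))^-1)%:E * y) `^ 2^-1 <= B%:E)%E.
  by apply: le_trans uB; apply: ereal_sup_ubound; exists J => //; exists k.
(* An infinite sum is excluded because its square root would be [+oo], above the finite bound. *)
clearbody y; move: y0; case: y => [y| |]//= y0; last first.
  by rewrite mulry gtr0_sg ?invr_gt0// mul1e/= invr_eq0 pnatr_eq0.
rewrite !lee_fin => H.
have z0 : 0 <= (fine (mu J))^-1 * y by rewrite mulr_ge0// invr_ge0 ltW.
rewrite -ler_pdivrMr// mulrC -[leLHS]sqr_sqrtr// -powR12_sqrt//.
by rewrite ler_pXn2r// nnegrE powR_ge0.
Qed.

End LatticeGeometry.

(** * Finite windows of a lattice *)

Lemma ler_sum_uniq_subset (R : numDomainType) (I : eqType) (s r : seq I) (F : I -> R) :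
  uniq s -> uniq r -> {subset s <= r} -> (forall i, 0 <= F i) ->
  \sum_(i <- s) F i <= \sum_(i <- r) F i.
Proof.
move=> us ur sr F0; rewrite [leRHS](bigID (fun i => i \in s))/= -[leLHS]addr0.
apply: lerD; last by apply: sumr_ge0.
have /(perm_big _) -> : perm_eq s [seq i <- r | i \in s].
  apply: uniq_perm; rewrite ?filter_uniq// => i; rewrite mem_filter.
  by case: (boolP (i \in s)) => // /sr ->.
by rewrite big_filter.
Qed.

(* A window is a finite set of atoms [atm o], intervals of generation [k0 + n],
   that contains with one atom all those under the same interval of generation
   [k0]; functions on it become functions on the finite type [Om]. *)
Section Window.
Context {R : realType} {X : set R} (L : lattice X).
Context (Om : finType) (atm : Om -> set R) (k0 : int) (n : nat).
Context (atm_gen : forall o, L (k0 + n%:Z) (atm o)).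
Context (atm_inj : injective atm).
Context (atm_saturated : forall o K J, L k0 K -> atm o `<=` K ->
  L (k0 + n%:Z) J -> J `<=` K -> exists o', atm o' = J).
Implicit Types (I J : set R) (f g b : R -> R) (phi psi : Om -> R).
Local Notation mu := (@lebesgue_measure R).

Definition atm_point o : R := xget 0 (atm o).

Definition block_of (k : nat) o : set R := cell L (k0 + k%:Z) (atm_point o).

Definition atm_weight o : R := fine (mu (atm o)).

(** Averages and not point values: [b] need not be constant on atoms, and only its averages enter
    integrals against step functions. *)
Definition restr f : Om -> R := fun o => avg (atm o) f.

Definition lift phi : R -> R := fun x => \sum_o phi o * \1_(atm o) x.

Lemma mem_atm_point o : atm o (atm_point o).
Proof.
have [x ax] := gen_neq0 (atm_gen o).
by rewrite /atm_point; case: xgetP => [y _ //|/(_ x)].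
Qed.

Lemma atm_subX o : atm o `<=` X.
Proof. exact: gen_subX (atm_gen o). Qed.

Lemma atm_point_X o : X (atm_point o).
Proof. exact/atm_subX/mem_atm_point. Qed.

Lemma atm_weight_gt0 o : 0 < atm_weight o.
Proof. exact: gen_measure_gt0 (atm_gen o). Qed.

Lemma atm_eq o o' x : atm o x -> atm o' x -> o = o'.
Proof. by move=> ox o'x; apply: atm_inj; exact: gen_eq (atm_gen o) (atm_gen o') ox o'x. Qed.

Lemma block_of_gen k o : L (k0 + k%:Z) (block_of k o).
Proof. exact/cell_gen/atm_point_X. Qed.

Lemma block_of_point k o : block_of k o (atm_point o).
Proof. exact/mem_cell/atm_point_X. Qed.

Lemma block_of_le k m o : (k <= m)%N -> block_of m o `<=` block_of k o.
Proof.
by move=> km; apply: cell_anti; [exact: atm_point_X|rewrite lerD2l lez_nat].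
Qed.

Lemma block_of_n o : block_of n o = atm o.
Proof. exact: cell_eq (atm_gen o) (mem_atm_point o). Qed.

Lemma block_of_inj : injective (block_of n).
Proof. by move=> o o'; rewrite !block_of_n => /atm_inj. Qed.

Lemma atm_sub_block k o : (k <= n)%N -> atm o `<=` block_of k o.
Proof. by move=> kn; rewrite -block_of_n; exact: block_of_le. Qed.

Lemma block_of_eq k o x : block_of k o x -> cell L (k0 + k%:Z) x = block_of k o.
Proof. exact: cell_eq (block_of_gen k o). Qed.

Lemma block_of_refine k o o' : block_of k.+1 o = block_of k.+1 o' ->
  block_of k o = block_of k o'.
Proof.
move=> e; apply/esym/block_of_eq; have := block_of_point k.+1 o'.
by rewrite -e => /(block_of_le (leqnSn k)).
Qed.

(** By saturation: the interval of generation [k0 + n] through [x] lies under the same interval of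
    generation [k0] as [atm o], hence is an atom. *)
Lemma block_of_atm k o x : block_of k o x -> exists o', atm o' x.
Proof.
move=> bx; have Xx := gen_subX (block_of_gen k o) bx.
have L0 : L k0 (block_of 0 o) by rewrite -[k0 in L k0]addr0; exact: block_of_gen.
have [] := @atm_saturated o (block_of 0 o) (cell L (k0 + n%:Z) x) L0.
- exact: atm_sub_block.
- exact: cell_gen.
- rewrite -(@block_of_eq 0 o x); last exact: block_of_le (leq0n k) _ bx.
  by apply: cell_anti => //; rewrite lerD2l lez_nat.
- by move=> o' ao'; exists o'; rewrite ao'; exact: mem_cell.
Qed.

Lemma block_of_bigsetU k o : (k <= n)%N -> block_of k o =
  \big[setU/set0]_(o' <- [seq o' <- enum Om | block_of k o' == block_of k o]) atm o'.
Proof.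
move=> kn; rewrite -bigcup_seq; apply/seteqP; split => x.
  move=> bx; have [i ai] := block_of_atm bx; exists i => //=.
  rewrite mem_filter mem_enum andbT; apply/eqP.
  by rewrite -(block_of_eq bx) (block_of_eq (atm_sub_block kn ai)).
move=> [ o' /=]; rewrite mem_filter mem_enum andbT => /eqP <- ao'.
exact: atm_sub_block ao'.
Qed.

Lemma trivIset_atm (D : set Om) : trivIset D atm.
Proof. by move=> o o' _ _ [x [ox o'x]]; exact: atm_eq ox o'x. Qed.

Lemma atm_measurable o : measurable (atm o : set (measurableTypeR R)).
Proof. exact: gen_measurable (atm_gen o). Qed.

Lemma avgE o f : \int[mu]_(x in atm o) f x = atm_weight o * restr f o.
Proof. by rewrite /restr /avg mulrA divff ?mul1r// gt_eqF ?atm_weight_gt0. Qed.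

Lemma Rintegral_atms (s : seq Om) f : uniq s ->
  measurable_fun (\big[setU/set0]_(o <- s) atm o : set (measurableTypeR R)) f ->
  (forall o, o \in s -> mu.-integrable (atm o) (EFin \o f)) ->
  \int[mu]_(x in \big[setU/set0]_(o <- s) atm o) f x =
  \sum_(o <- s) atm_weight o * restr f o.
Proof.
move=> us mf fint; rewrite /Rintegral integral_bigsetU_EFin//.
- rewrite big_seq -sum_fine; last first.
    by move=> o os; apply: integrable_fin_num; [exact: atm_measurable|exact: fint].
  by rewrite -big_seq; apply: eq_bigr => o _; rewrite -avgE.
- exact: atm_measurable.
- exact: trivIset_atm.
- exact/measurable_EFinP.
Qed.

Lemma measure_atms (s : seq Om) : uniq s ->
  fine (mu (\big[setU/set0]_(o <- s) atm o)) = \sum_(o <- s) atm_weight o.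
Proof.
move=> us; rewrite -bigcup_seq measure_fin_bigcup//.
- rewrite -fsbig_seq// -sum_fine// => o _.
  by have [r _ e] := gen_measure (atm_gen o); rewrite [X in X \is a _]e.
- exact: trivIset_atm.
- by move=> o _; exact: atm_measurable.
Qed.

Lemma cexp_restr k o f : (k <= n)%N -> mu.-integrable (block_of k o) (EFin \o f) ->
  cexp atm_weight block_of k (restr f) o = avg (block_of k o) f.
Proof.
move=> kn fint; have us : uniq [seq o' <- enum Om | block_of k o' == block_of k o].
  by rewrite filter_uniq// enum_uniq.
rewrite /avg (block_of_bigsetU o kn) measure_atms// Rintegral_atms//.
- rewrite !big_filter !big_enum_cond/= mulrC.
  by congr (_ / _); apply: eq_bigl => o'; rewrite ?andbT.
- rewrite -block_of_bigsetU//; apply/measurable_EFinP; exact: measurable_int fint.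
- move=> o'; rewrite mem_filter => /andP[/eqP e _].
  apply: integrableS fint; [exact: gen_measurable (block_of_gen _ _)|exact: atm_measurable|].
  by rewrite -e; exact: atm_sub_block.
Qed.

Lemma lift_atm phi o x : atm o x -> lift phi x = phi o.
Proof.
move=> ox; rewrite /lift (bigD1 o)//= indicE mem_set// mulr1 big1 ?addr0//.
move=> o' o'o; rewrite indicE memNset ?mulr0// => o'x.
by move: o'o; rewrite (atm_eq o'x ox) eqxx.
Qed.

Lemma lift_notin phi x : (forall o, ~ atm o x) -> lift phi x = 0.
Proof. by move=> nx; rewrite /lift big1// => o _; rewrite indicE memNset ?mulr0. Qed.

Lemma lift_cases x : (exists o, atm o x) \/ (forall o, ~ atm o x).
Proof.
have [|nx] := pselect (exists o, atm o x); first by left.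
by right=> o ox; apply: nx; exists o.
Qed.

Lemma measurable_lift phi (D : set (measurableTypeR R)) : measurable_fun D (lift phi).
Proof.
apply: (measurable_funS measurableT) => //; rewrite /lift.
apply: measurable_sum => o; apply: measurable_funM => //.
by apply: measurable_indic; exact: atm_measurable.
Qed.

(** A lift vanishes off the atoms and is constant on each, so only the averages of [b] matter,
    whatever [Y] contains besides the atoms. *)
Lemma Rintegral_liftM (Y : set R) phi b : (forall o, atm o `<=` Y) ->
  measurable_fun (\bigcup_o atm o : set (measurableTypeR R)) b ->
  (forall o, mu.-integrable (atm o) (EFin \o b)) ->
  \int[mu]_(x in Y) (lift phi x * b x) = wsum atm_weight (fun o => phi o * restr b o).
Proof.
move=> atmY mb bint; pose D := \big[setU/set0]_(o <- enum Om) atm o.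
have DE : D = \bigcup_o atm o.
  by rewrite /D -bigcup_seq; apply: eq_bigcupl; split => o //= _; rewrite mem_enum.
transitivity (\int[mu]_(x in D) (lift phi x * b x)).
  rewrite Rintegral_mkcond [RHS]Rintegral_mkcond; congr Rintegral.
  apply/funext => x; rewrite !patchE DE.
  have [[i ox]|nx] := lift_cases x.
    by rewrite !mem_set//; [exists i|exact: atmY ox].
  by rewrite lift_notin// mul0r; case: ifP; case: ifP.
rewrite Rintegral_atms ?enum_uniq//.
- rewrite big_enum/=; apply: eq_bigr => o _; congr (_ * _); rewrite /restr /avg.
  rewrite mulrCA; congr (_ * _); rewrite -RintegralZl//; last exact: atm_measurable.
  by apply: eq_Rintegral => x; rewrite inE => ox; rewrite (lift_atm _ ox).
- by rewrite -/D DE; apply: measurable_funM => //; exact: measurable_lift.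
- move=> o _; have E : {in atm o, (fun x => (phi o)%:E * (EFin \o b) x)%E =1
      EFin \o (fun x => lift phi x * b x)}.
    by move=> x; rewrite inE => ox /=; rewrite (lift_atm _ ox).
  exact: eq_integrable (atm_measurable o) _ _ E (integrableZl (atm_measurable o) _ (bint o)).
Qed.

Lemma atm_finite_measure o : (mu (atm o) < +oo)%E.
Proof. exact: gen_measure_lty (atm_gen o). Qed.

Lemma integrable_cst_atm (c : R) o : mu.-integrable (atm o) (EFin \o cst c).
Proof.
apply: measurable_bounded_integrable; [exact: atm_measurable|exact: atm_finite_measure| |].
  exact: measurable_cst.
exact: bounded_cst.
Qed.

Lemma restr_cst (c : R) o : restr (cst c) o = c.
Proof.
rewrite /restr /avg Rintegral_cst; last exact: atm_measurable.
by rewrite mulrCA mulVf ?mulr1// gt_eqF ?atm_weight_gt0.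
Qed.

Lemma Rintegral_lift (Y : set R) phi : (forall o, atm o `<=` Y) ->
  \int[mu]_(x in Y) lift phi x = wsum atm_weight phi.
Proof.
move=> atmY; transitivity (\int[mu]_(x in Y) (lift phi x * cst 1 x)).
  by apply: eq_Rintegral => x _; rewrite mulr1.
rewrite Rintegral_liftM//; last by move=> o; exact: integrable_cst_atm.
by apply: eq_bigr => o _; rewrite restr_cst mulr1.
Qed.

Lemma Rintegral_lift_on (D : set R) phi :
  (forall o, atm o `<=` D \/ (forall x, D x -> ~ atm o x)) ->
  \int[mu]_(x in D) lift phi x =
  wsum atm_weight (fun o => (if `[< atm o `<=` D >] then 1 else 0) * phi o).
Proof.
move=> dich; rewrite Rintegral_mkcond -(Rintegral_lift (Y := setT))//.
congr Rintegral; apply/funext => x; rewrite patchE.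
have [[i ox]|nx] := lift_cases x; last by rewrite !lift_notin//; case: ifP.
rewrite !(lift_atm _ ox); case: asboolP => iD; first by rewrite mem_set ?mul1r//; exact: iD.
by rewrite memNset ?mul0r// => Dx; case: (dich i) => // /(_ _ Dx).
Qed.

Lemma integrable_lift phi (D : set (measurableTypeR R)) : measurable D -> mu.-integrable D (EFin \o lift phi).
Proof.
move=> mD; apply: (integrableS measurableT) => //.
rewrite (_ : EFin \o lift phi = (fun x => \sum_(o <- enum Om) ((phi o)%:E * (\1_(atm o) x)%:E)%E)%E).
  apply: integrable_sum => // o _; apply: integrableZl => //.
  have := integrable_cst_atm 1 o.
  rewrite (integrable_mkcond _ (atm_measurable o)); apply: eq_integrable => // x _.
  by rewrite patchE indicE; case: ifP.
apply/funext => x /=; rewrite /lift -sumEFin big_enum/=.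
by apply: eq_bigr => o _; rewrite EFinM.
Qed.

Lemma restr_lift phi : restr (lift phi) = phi.
Proof.
apply/funext => o; rewrite -[RHS](restr_cst (phi o) o) /restr /avg; congr (_ * _).
by apply: eq_Rintegral => x; rewrite inE => ox; rewrite (lift_atm _ ox).
Qed.

(** * Lattice differences as martingale differences *)

Local Notation E := (cexp atm_weight block_of).
Local Notation D := (mdiff atm_weight block_of).
Local Notation sumw := (wsum atm_weight).
Local Notation adapt := (adapted block_of).
Local Notation rank_at k o := (is_rank L (block_of k o) (k0 + k%:Z)).

Lemma window_indexS k : k0 + k%:Z + 1 = k0 + k.+1%:Z.
Proof. by rewrite -addrA -PoszD addn1. Qed.

Lemma cell_atm k o x : (k <= n)%N -> atm o x -> cell L (k0 + k%:Z) x = block_of k o.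
Proof. by move=> kn /(atm_sub_block kn)/block_of_eq. Qed.

Lemma mdiff_restr k o f : (k < n)%N -> lattice_integrable L f ->
  D k (restr f) o = avg (block_of k.+1 o) f - avg (block_of k o) f.
Proof.
move=> kn fint; rewrite /mdiff !cexp_restr ?(ltnW kn)//; apply: fint.
  by exists (k0 + k%:Z) => //; exact: block_of_gen.
by exists (k0 + k.+1%:Z) => //; exact: block_of_gen.
Qed.

Lemma Delta_block k o o' f x : (k < n)%N -> rank_at k o -> lattice_integrable L f ->
  block_of k o' = block_of k o -> atm o' x ->
  Delta L (block_of k o) f x = D k (restr f) o'.
Proof.
move=> kn rk fint e o'x; rewrite mdiff_restr// -e (@Delta_rank _ _ _ _ (k0 + k%:Z)).
- by rewrite window_indexS (cell_atm _ o'x).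
- by rewrite e.
- exact: atm_sub_block (ltnW kn) _ o'x.
Qed.

(** A block without this rank reappears in the next generation, so levels [k] and [k + 1] have the
    same block there. *)
Lemma mdiff_no_rank k o phi : ~ rank_at k o -> D k phi o = 0.
Proof.
move=> nrk; have Lk1 : L (k0 + k.+1%:Z) (block_of k o).
  rewrite -window_indexS; apply: contrapT => nL; apply: nrk.
  by apply/(is_rankP (block_of_gen k o)).
suff e o' : (block_of k.+1 o' == block_of k.+1 o) = (block_of k o' == block_of k o).
  rewrite /mdiff /cexp (eq_bigl _ _ e) [X in _ / X - _](eq_bigl _ _ e).
  exact: subrr.
apply/eqP/eqP; first exact: block_of_refine.
move=> e; have B o1 : block_of k o (atm_point o1) -> block_of k.+1 o1 = block_of k o.
  by move=> /(cell_eq Lk1).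
by rewrite !B//; [exact: block_of_point|rewrite -e; exact: block_of_point].
Qed.

(** The rank test keeps an interval that persists through several generations from being counted at
    each of them. *)
Lemma sum_lattice (V : set R -> R -> R) o x : atm o x ->
  (forall I, mem_lattice L I -> V I x <> 0 ->
     I x /\ exists2 k, (k < n)%N & is_rank L I (k0 + k%:Z)) ->
  \sum_(I \in mem_lattice L) V I x =
  \sum_(0 <= k < n) if `[< rank_at k o >] then V (block_of k o) x else 0.
Proof.
move=> ox HV.
pose r := [seq block_of k o | k <- [seq k <- index_iota 0 n | `[< rank_at k o >]]].
have ur : uniq r.
  rewrite map_inj_in_uniq ?filter_uniq ?iota_uniq// => i j.
  rewrite !mem_filter => /andP[/asboolP ri _] /andP[/asboolP rj _] e.
  rewrite -e in rj; have /addrI := is_rank_uniq ri rj; by case.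
rewrite -big_mkcond -big_filter -(big_map (fun k => block_of k o) xpredT (fun I => V I x)).
rewrite -/r (fsbig_seq _ _ ur); apply/esym/fsbig_widen.
  move=> I /= /mapP[k _ ->]; exists (k0 + k%:Z) => //; exact: block_of_gen.
move=> I /= [LI nIr]; apply: contrapT => VN0; apply: nIr.
have [Ix [k kn rk]] := HV _ LI VN0.
have e : block_of k o = I.
  by rewrite -(cell_atm (ltnW kn) ox); apply: cell_eq Ix; case: rk.
apply/mapP; exists k => //; rewrite mem_filter mem_index_iota kn andbT.
by rewrite andbT; apply/asboolP; rewrite e.
Qed.

Lemma sumw_centered_adapted0 phi h : (forall o, E 0 phi o = 0) -> adapt 0%N h ->
  sumw (fun o => h o * phi o) = 0.
Proof.
move=> phi0 h0; rewrite -(wsum_cexpr atm_weight_gt0 _ h0).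
by rewrite (eq_wsum _ (g := fun o => 0 * 0)) ?wsumZ ?mul0r// => o; rewrite phi0 mulr0.
Qed.

(** The indicator of such a [Y] is constant on the coarsest blocks of the window, hence orthogonal
    to a centered function. This covers intervals of generation at most [k0] and the top
    intervals. *)
Lemma coarse_Rintegral_lift phi (Y : set R) : (forall o, E 0 phi o = 0) ->
  (forall K, L k0 K -> K `<=` Y \/ (forall x, Y x -> ~ K x)) ->
  \int[mu]_(x in Y) lift phi x = 0.
Proof.
move=> phi0 dichY; have L0 o : L k0 (block_of 0 o).
  by have := block_of_gen 0 o; rewrite addr0.
rewrite Rintegral_lift_on; last first.
  move=> o; have [KY|KY] := dichY _ (L0 o); [left|right].
    by apply: subset_trans KY; exact: atm_sub_block.
  by move=> x Yx ox; apply: (KY x Yx); exact: atm_sub_block ox.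
apply: sumw_centered_adapted0 => // o o' e; congr (if _ then _ else _).
apply: asbool_equiv_eq; suff H o1 : atm o1 `<=` Y <-> block_of 0 o1 `<=` Y.
  by rewrite !H e.
split; last by apply: subset_trans; exact: atm_sub_block.
move=> o1Y; have [//|KY] := dichY _ (L0 o1).
exfalso; have := mem_atm_point o1 => p1.
by apply: (KY _ (o1Y _ p1)); exact: atm_sub_block p1.
Qed.

Lemma avg_cst m I f (c : R) : L m I -> (forall x, I x -> f x = c) -> avg I f = c.
Proof.
move=> LI fc; rewrite /avg (eq_Rintegral _ (g := cst c)).
  rewrite Rintegral_cst; last exact: gen_measurable LI.
  by rewrite mulrCA mulVf ?mulr1// gt_eqF// (gen_measure_gt0 LI).
by move=> x; rewrite inE => /fc.
Qed.

Lemma lift_fine m I phi : L m I -> k0 + n%:Z <= m ->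
  exists c, forall x, I x -> lift phi x = c.
Proof.
move=> LI nm; have [[i [x [Ix ix]]]|nx] := pselect (exists i x, I x /\ atm i x).
  exists (phi i) => y Iy; apply: lift_atm.
  exact: gen_nested nm (atm_gen i) LI ix Ix y Iy.
exists 0 => x Ix; rewrite lift_notin// => i ix; apply: nx.
by exists i, x.
Qed.

(** Coarse intervals see only zero averages, fine ones only a constant, and those of intermediate
    rank that miss the atoms see zero. *)
Lemma Delta_lift_support phi I : (forall o, E 0 phi o = 0) ->
  Delta L I (lift phi) <> cst 0 ->
  exists k o, [/\ (k < n)%N, I = block_of k o & rank_at k o].
Proof.
move=> phi0 DN0; have [m rm] : exists m, is_rank L I m.
  by apply: contrapT => nrk; apply: DN0; exact: Delta_no_rank.
have LI := is_rank_gen rm.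
have coarse (j : int) J : L j J -> j <= k0 -> avg J (lift phi) = 0.
  move=> LJ jk; rewrite /avg coarse_Rintegral_lift ?mulr0// => K LK.
  have [|nx] := pselect (exists x, J x /\ K x).
    by move=> [x [Jx Kx]]; left; exact: gen_nested jk LJ LK Jx Kx.
  by right=> x Jx Kx; apply: nx; exists x.
apply: contrapT => nblock; apply: DN0; apply/funext => x /=.
have [Ix|/Delta_notin -> //] := pselect (I x).
have Xx := gen_subX LI Ix; rewrite (Delta_rank _ rm Ix).
have LJ := cell_gen L (m + 1) Xx.
have JI : cell L (m + 1) x `<=` I by rewrite -(cell_eq LI Ix); exact: cellS.
(* The strict inequality keeps the children at generation [m + 1 <= k0], where averages still
   vanish; rank [k0] already belongs to the window. *)
have [mk|km] := ltP m k0.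
  by rewrite (coarse _ _ LI (ltW mk)) (coarse _ _ LJ) ?subrr// lezD1.
have cst_case c : (forall y, I y -> lift phi y = c) ->
    avg (cell L (m + 1) x) (lift phi) - avg I (lift phi) = 0.
  by move=> Ic; rewrite (avg_cst LI Ic) (avg_cst LJ (fun y Jy => Ic y (JI y Jy))) subrr.
have [nm|mn] := leP (k0 + n%:Z) m.
  by have [c Ic] := lift_fine phi LI nm; exact: cst_case Ic.
have [[i [y [Iy iy]]]|ni] := pselect (exists i y, I y /\ atm i y); last first.
  apply: (cst_case 0) => y Iy; rewrite lift_notin// => i iy; apply: ni.
  by exists i, y.
exfalso; apply: nblock; exists `|m - k0|%N, i.
have em : k0 + `|m - k0|%N%:Z = m by rewrite gez0_abs ?subr_ge0// subrKC.
have kn : (`|m - k0| < n)%N by rewrite -ltz_nat -(ltrD2l k0) em.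
have eI : I = block_of `|m - k0| i.
  by rewrite -(cell_atm (ltnW kn) iy) em (cell_eq LI Iy).
by split=> //; rewrite -eI em.
Qed.

Lemma chain_mem s j : is_chain L s -> L j (s j).
Proof. by move=> /(_ j)[]. Qed.

Lemma chain_anti s i j : is_chain L s -> i <= j -> s j `<=` s i.
Proof.
move=> ch ij; have -> : j = i + (`|j - i|%N)%:Z by rewrite gez0_abs ?subr_ge0// subrKC.
elim: `|j - i|%N => [|l IH]; first by rewrite addr0.
rewrite -addn1 PoszD addrA; apply: subset_trans IH.
by have [_] := ch (i + l%:Z + 1); rewrite addrK.
Qed.

Lemma measurable_top I : top_intervals L I -> measurable (I : set (measurableTypeR R)).
Proof.
move=> [s ch ->]; apply: countable_bigcupT_measurable; first exact: countableP.
by move=> i; exact: gen_measurable (chain_mem i ch).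
Qed.

Lemma admissible_lift phi : admissible L (lift phi).
Proof.
split; first exact: measurable_lift.
move=> s ch x y xs ys; have [c cs] := lift_fine phi (chain_mem (k0 + n%:Z) ch) (lexx _).
by rewrite !cs//; [exact: ys|exact: xs].
Qed.

(** If [K] meets a member of the chain, either that member is coarser and contains [K], or the chain
    member of generation [k] meets [K] and equals it. *)
Lemma top_dichotomy Y K k : top_intervals L Y -> L k K ->
  K `<=` Y \/ (forall x, Y x -> ~ K x).
Proof.
move=> [s ch ->] LK; have [|nx] := pselect (exists j x, s j x /\ K x); last first.
  by right=> x [j _ sjx] Kx; apply: nx; exists j, x.
move=> [j [x [sjx Kx]]]; left=> y Ky.
have [jk|kj] := leP j k.
  by exists j => //; exact: gen_nested jk (chain_mem j ch) LK sjx Kx y Ky.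
exists k => //; rewrite (gen_eq (chain_mem k ch) LK _ Kx)//.
exact: chain_anti ch (ltW kj) _ sjx.
Qed.

(** Centering makes the averages over top and coarse intervals vanish. Without it, the differences
    at infinitely many coarse intervals could be nonzero. *)
Lemma finite_sum_lift phi : (forall o, E 0 phi o = 0) -> finite_sum L (lift phi).
Proof.
move=> phi0.
have Expect0 I : fin_top_intervals L I -> Expect I (lift phi) = cst 0.
  move=> [tI _]; apply/funext => x; rewrite /Expect /avg.
  rewrite coarse_Rintegral_lift ?mulr0 ?mul0r// => K LK; exact: top_dichotomy tI LK.
split; first exact: admissible_lift.
- move=> I [[k _ LI]|[tI _]]; apply: integrable_lift.
    exact: gen_measurable LI.
  exact: measurable_top.
- apply: (@sub_finite_set _ _ ((fun p : 'I_n * Om => block_of p.1 p.2) @` setT)).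
    move=> I [_ /(Delta_lift_support phi0)[k [i1 [kn -> _]]]].
    by exists (Ordinal kn, i1).
  by apply: finite_image; exact: finite_finset.
- rewrite (_ : [set _ | _] = set0)//; apply/seteqP; split => I // [tI].
  by rewrite (Expect0 _ tI).
- move=> x Xx; rewrite [X in _ + X]fsbig1; last first.
    by move=> I tI; rewrite (Expect0 _ tI).
  rewrite addr0; have [[i ix]|nx] := lift_cases x; last first.
    rewrite lift_notin// fsbig1// => I _; apply: contrapT => DN0.
    have [|k [i1 [kn eI _]]] := @Delta_lift_support phi I phi0.
      by move=> D0; apply: DN0; rewrite D0.
    have [Ix|nIx] := pselect (I x); last by apply: DN0; exact: Delta_notin.
    by move: Ix; rewrite eI => /block_of_atm[j]; exact: nx.
  rewrite (@sum_lattice (fun I => Delta L I (lift phi)) i x ix); last first.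
    move=> I _ DN0; split; first by apply: contrapT => /(@Delta_notin _ _ L _ (lift phi)).
    have [|k [i1 [kn eI rk]]] := @Delta_lift_support phi I phi0.
      by move=> D0; apply: DN0; rewrite D0.
    by exists k => //; rewrite eI.
  have lint : lattice_integrable L (lift phi).
    by move=> I [k _ LI]; apply: integrable_lift; exact: gen_measurable LI.
  rewrite (lift_atm _ ix).
  have -> : phi i = E n phi i by rewrite (cexp_adapted atm_weight_gt0)// => j j' /block_of_inj ->.
  rewrite (cexp_sum_mdiff _ _ n) phi0 add0r -(big_mkord xpredT (fun k => D k phi i)) !big_nat.
  apply: eq_bigr => k /andP[_ kn]; case: asboolP => [rk|/mdiff_no_rank -> //].
  by rewrite (Delta_block kn rk lint erefl ix) restr_lift.
Qed.

Lemma Lpnorm_lift (p : R) phi : 0 < p ->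
  Lpnorm X p%:E (lift phi) = (lpnorm atm_weight p phi)%:E.
Proof.
move=> p0; rewrite /Lpnorm unlock lpnormE lpsumE -poweR_EFin; congr (_ `^ _)%E.
rewrite (_ : (fun x => _) = EFin \o lift (fun o => `|phi o| `^ p)).
  rewrite -[LHS]fineK ?integrable_fin_num//; last exact: integrable_lift.
  by congr EFin; exact: Rintegral_lift.
apply/funext => x /=; rewrite patchE.
have [[i ix]|nx] := lift_cases x.
  by rewrite !(lift_atm _ ix) mem_set//; exact: atm_subX ix.
by rewrite !lift_notin//; case: ifP => _ /=; rewrite normr0 powR0// gt_eqF.
Qed.

Lemma le_lpnorm_Lpnorm (p : R) f F : measurable (X : set (measurableTypeR R)) ->
  0 < p -> measurable_fun X f ->
  (forall o x, atm o x -> f x = F o) ->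
  ((lpnorm atm_weight p F)%:E <= Lpnorm X p%:E f)%E.
Proof.
move=> mX p0 mf fF; rewrite -Lpnorm_lift// /Lpnorm unlock.
have mE (g : R -> R) : measurable_fun (setT : set (measurableTypeR R)) (g \_ X) ->
    measurable_fun (setT : set (measurableTypeR R))
      (fun x => (`|(EFin \o (g \_ X)) x| `^ p)%E).
  move=> mg; apply/measurable_EFinP.
  exact: (measurableT_comp (measurable_powR p) (measurableT_comp (@normr_measurable R setT) mg)).
apply: gt0_ler_poweR; rewrite ?invr_ge0 ?(ltW p0)// ?in_itv/= ?leey ?andbT.
- by apply: integral_ge0 => x _; rewrite lee_fin powR_ge0.
- by apply: integral_ge0 => x _; rewrite lee_fin powR_ge0.
apply: ge0_le_integral => //.
- exact: mE (iffLR (measurable_restrictT _ mX) (measurable_lift F (D := X))).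
- exact: mE (iffLR (measurable_restrictT _ mX) mf).
- move=> x _; rewrite /= lee_fin; apply: ge0_ler_powR; rewrite ?nnegrE ?(ltW p0)//.
  rewrite !patchE; case: ifP => // _; have [[i ix]|nx] := lift_cases x.
    by rewrite (lift_atm _ ix) (fF _ _ ix).
  by rewrite lift_notin// normr0.
Qed.

(** On a bounded interval [|f| <= 1 + f^2]. Elements of [D_I] come from functions in [L^2], whose
    averages must be genuine integrals for the window to compute them. *)
Lemma L2_lattice_integrable f : measurable (X : set (measurableTypeR R)) ->
  measurable_fun X f -> (Lpnorm X 2%:E f < +oo)%E -> lattice_integrable L f.
Proof.
move=> mX mf; rewrite /Lpnorm unlock => /lty_poweRy.
rewrite invr_eq0 pnatr_eq0 => /(_ isT) f2 I [m _ LI].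
have mI := gen_measurable LI.
have mfX : measurable_fun (setT : set (measurableTypeR R)) (f \_ X).
  exact: (iffLR (measurable_restrictT _ mX) mf).
have m2 : measurable_fun (setT : set (measurableTypeR R)) (fun x => (f \_ X) x ^+ 2).
  exact: measurable_funX.
have int2 : mu.-integrable I (EFin \o (fun x => (f \_ X) x ^+ 2)).
  apply: (integrableS measurableT) => //; apply/integrableP; split.
    exact/measurable_EFinP.
  apply: le_lt_trans f2; rewrite le_eqVlt; apply/orP; left; apply/eqP.
  by apply: eq_integral => x _ /=; rewrite powR_mulrn// normrX.
have int1 : mu.-integrable I (EFin \o cst 1).
  apply: measurable_bounded_integrable; [exact: mI| | |exact: bounded_cst].
    exact: gen_measure_lty LI.
  exact: measurable_cst.
apply: (le_integrable mI _ _ (integrableD mI int1 int2)).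
  by apply/measurable_EFinP; exact: measurable_funS mX (gen_subX LI) mf.
move=> x Ix; rewrite /= patchE mem_set; last exact: gen_subX LI _ Ix.
rewrite lee_fin [leRHS]ger0_norm ?addr_ge0 ?sqr_ge0//.
rewrite -[f x ^+ 2]real_normK ?num_real//.
by have := sqr_ge0 (`|f x| - 2^-1); rewrite sqrrB; move: (`|f x|) => y; lra.
Qed.

(** Coordinates of an element of [D_I] on the window. Point values suffice since such an element is
    constant on atoms, see [Dspace_point]. *)
Definition trace k o (u : R -> R) : Om -> R := fun o' =>
  if block_of k o' == block_of k o then u (atm_point o') else 0.

(** * The space [D_I] of one block *)

Section Block.
Context (mX : measurable (X : set (measurableTypeR R))) (k : nat) (o : Om).
Context (kn : (k < n)%N) (rk : rank_at k o).
Local Notation I := (block_of k o).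

Lemma lattice_integrable_lift phi : lattice_integrable L (lift phi).
Proof. by move=> J [m _ LJ]; apply: integrable_lift; exact: gen_measurable LJ. Qed.

Lemma Dspace_Delta_lift phi : Dspace L I (Delta L I (lift phi)).
Proof.
exists (lift phi); split=> //; first exact: admissible_lift.
by rewrite Lpnorm_lift// ltry.
Qed.

Lemma DspaceP u : Dspace L I u ->
  (forall x, ~ I x -> u x = 0) /\
  exists phi, forall o' x, block_of k o' = I -> atm o' x -> u x = D k phi o'.
Proof.
move=> [f [[mf _] f2 ->]]; split; first by move=> x; exact: Delta_notin.
exists (restr f) => o' x e ox; apply: Delta_block => //.
exact: L2_lattice_integrable.
Qed.

Lemma Dspace_point u o' x : Dspace L I u -> atm o' x -> u x = u (atm_point o').
Proof.
move=> /DspaceP[u0 [phi uphi]] ox.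
have [e|ne] := pselect (block_of k o' = I).
  by rewrite (uphi _ _ e ox) (uphi _ _ e (mem_atm_point o')).
rewrite !u0// => Ix; apply: ne.
  by rewrite -(block_of_eq Ix).
by rewrite -(block_of_eq Ix) (cell_atm (ltnW kn) ox).
Qed.

Lemma trace_out u o' : block_of k o' <> I -> trace k o u o' = 0.
Proof. by move=> /eqP/negbTE ne; rewrite /trace ne. Qed.

Lemma trace_mdiff u : Dspace L I u ->
  exists phi, forall o', block_of k o' = I -> trace k o u o' = D k phi o'.
Proof.
move=> /DspaceP[_ [phi uphi]]; exists phi => o' e.
by rewrite /trace e eqxx (uphi _ _ e (mem_atm_point o')).
Qed.

Lemma adapted_trace u : Dspace L I u -> adapt k.+1 (trace k o u).
Proof.
move=> /trace_mdiff[phi uphi] i j ij; have kij := block_of_refine ij.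
have [e|ne] := pselect (block_of k i = I); last by rewrite !trace_out// -kij.
have A : adapt k.+1 (D k phi) by apply: adapted_mdiff; exact: block_of_refine.
by rewrite !uphi// -?kij//; exact: A.
Qed.

Lemma cexp_trace u o' : Dspace L I u -> E k (trace k o u) o' = 0.
Proof.
move=> /trace_mdiff[phi uphi].
have [e|ne] := pselect (block_of k o' = I).
  rewrite (eq_cexp_block _ (g := D k phi)); last by move=> i /= ei; rewrite uphi// ei.
  exact: (cexp_mdiff atm_weight_gt0 block_of_refine).
rewrite (eq_cexp_block _ (g := fun=> 0)) ?(cexp_adapted atm_weight_gt0)//.
by move=> i /= ei; rewrite trace_out// ei.
Qed.

Lemma mdiff_trace u : Dspace L I u -> D k (trace k o u) =1 trace k o u.
Proof.
move=> Du o'; rewrite /mdiff cexp_trace// subr0 (cexp_adapted atm_weight_gt0)//.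
exact: adapted_trace.
Qed.

Lemma Delta_lift_point phi o' x : block_of k o' = I -> atm o' x ->
  Delta L I (lift phi) x = D k phi o'.
Proof.
move=> e ox; rewrite (Delta_block kn rk (lattice_integrable_lift phi) e ox).
by rewrite restr_lift.
Qed.

Lemma trace_Delta_lift phi o' : block_of k o' = I ->
  trace k o (Delta L I (lift phi)) o' = D k phi o'.
Proof.
by move=> e; rewrite /trace e eqxx (Delta_lift_point _ e (mem_atm_point o')).
Qed.

Lemma Dspace_trace_inj u v : Dspace L I u -> Dspace L I v ->
  trace k o u =1 trace k o v -> u = v.
Proof.
move=> Du Dv uv; apply/funext => x; have [u0 _] := DspaceP Du; have [v0 _] := DspaceP Dv.
have [Ix|nIx] := pselect (I x); last by rewrite u0// v0.
have [i ix] := block_of_atm Ix.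
have e : block_of k i = I by rewrite -(cell_atm (ltnW kn) ix) (block_of_eq Ix).
have := uv i; rewrite /trace e eqxx.
by rewrite (Dspace_point Du ix) (Dspace_point Dv ix).
Qed.

Lemma Delta_lift_trace u : Dspace L I u -> Delta L I (lift (trace k o u)) = u.
Proof.
move=> Du; apply: Dspace_trace_inj => //; first exact: Dspace_Delta_lift.
move=> o'; have [e|ne] := pselect (block_of k o' = I).
  by rewrite trace_Delta_lift// mdiff_trace.
by rewrite !trace_out.
Qed.

Lemma pairing_Dspace u v : Dspace L I u -> Dspace L I v ->
  pairing X u v = sumw (fun o' => trace k o u o' * trace k o v o').
Proof.
move=> Du Dv; have [u0 _] := DspaceP Du; rewrite /pairing -(Rintegral_lift (Y := X)).
  apply: eq_Rintegral => x _; have [[i ix]|nx] := lift_cases x.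
    rewrite (lift_atm _ ix); have [e|ne] := pselect (block_of k i = I).
      by rewrite /trace e eqxx (Dspace_point Du ix) (Dspace_point Dv ix).
    rewrite trace_out// mul0r u0 ?mul0r// => Ix; apply: ne.
    by rewrite -(cell_atm (ltnW kn) ix) (block_of_eq Ix).
  rewrite lift_notin// u0 ?mul0r// => Ix.
  by have [i] := block_of_atm Ix; exact: nx.
exact: atm_subX.
Qed.

Lemma Delta_lift_eq phi psi : (forall o', D k phi o' = D k psi o') ->
  Delta L I (lift phi) = Delta L I (lift psi).
Proof.
move=> e; apply: Dspace_trace_inj; [exact: Dspace_Delta_lift..|move=> o'].
have [eo|ne] := pselect (block_of k o' = I); first by rewrite !trace_Delta_lift.
by rewrite !trace_out.
Qed.

Lemma Delta_lift_linear (a : R) phi psi :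
  Delta L I (lift (fun o' => a * phi o' + psi o')) =
  (fun x => a * Delta L I (lift phi) x + Delta L I (lift psi) x).
Proof.
apply/funext => x; have [Ix|nIx] := pselect (I x); last first.
  by rewrite !Delta_notin// mulr0 addr0.
have [i ix] := block_of_atm Ix.
have e : block_of k i = I by rewrite -(cell_atm (ltnW kn) ix) (block_of_eq Ix).
by rewrite !(Delta_lift_point _ e ix) /mdiff !cexpD !cexpZ; ring.
Qed.

Lemma pairing_definite u : Dspace L I u -> pairing X u u = 0 -> u = cst 0.
Proof.
move=> Du; rewrite pairing_Dspace// => /eqP; rewrite psumr_eq0; last first.
  by move=> i _; rewrite mulr_ge0 ?(ltW (atm_weight_gt0 _))// -expr2 sqr_ge0.
move=> /allP u0; apply/funext => x; have [uI _] := DspaceP Du.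
have [Ix|nIx] := pselect (I x); last by rewrite uI.
have [i ix] := block_of_atm Ix.
have e : block_of k i = I by rewrite -(cell_atm (ltnW kn) ix) (block_of_eq Ix).
have := u0 i (mem_index_enum _); rewrite mulf_eq0 gt_eqF ?atm_weight_gt0//=.
rewrite mulf_eq0 orbb /trace e eqxx => /eqP.
by rewrite (Dspace_point Du ix).
Qed.

(* The coefficients of the representing vector are read off on the indicators
   of single atoms. *)
Lemma adjoint_exists (A : (R -> R) -> R -> R) v :
  (forall u, Dspace L I u -> Dspace L I (A u)) ->
  (forall (a : R) u u', Dspace L I u -> Dspace L I u' ->
    A (fun x => a * u x + u' x) = (fun x => a * A u x + A u' x)) ->
  Dspace L I v ->
  exists w, Dspace L I w /\
    forall u, Dspace L I u -> pairing X (A u) v = pairing X u w.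
Proof.
move=> Ast Alin Dv.
pose ell phi := pairing X (A (Delta L I (lift phi))) v.
have DA phi : Dspace L I (A (Delta L I (lift phi))) by exact/Ast/Dspace_Delta_lift.
have ell_lin (a : R) phi psi :
    ell (fun o' => a * phi o' + psi o') = a * ell phi + ell psi.
  rewrite /ell !pairing_Dspace// -wsumZ -wsumD; apply: eq_wsum => o'.
  rewrite Delta_lift_linear Alin ?/trace; try exact: Dspace_Delta_lift.
  by case: ifP => _; ring.
have ell0 : ell (fun=> 0) = 0.
  have := ell_lin (-1) (fun=> 0) (fun=> 0).
  rewrite (_ : (fun o' => _) = fun=> 0); last by apply/funext => o'; ring.
  lra.
pose dlt (i o' : Om) : R := (o' == i)%:R.
have ell_sum (c : Om -> R) (r : seq Om) :
    ell (fun o' => \sum_(i <- r) c i * dlt i o') = \sum_(i <- r) c i * ell (dlt i).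
  elim: r => [|i r IH].
    rewrite big_nil -[RHS]ell0; congr ell; apply/funext => o'; exact: big_nil.
  rewrite big_cons -IH -ell_lin; congr ell; apply/funext => o'; exact: big_cons.
pose c i := ell (dlt i) / atm_weight i.
exists (Delta L I (lift c)); split; first exact: Dspace_Delta_lift.
move=> u Du; have Dc := Dspace_Delta_lift c.
transitivity (sumw (fun o' => trace k o u o' * c o')).
  rewrite -[in LHS](Delta_lift_trace Du) -/(ell _).
  rewrite (_ : trace k o u = fun o' => \sum_i trace k o u i * dlt i o').
    rewrite ell_sum; apply: eq_bigr => i _; rewrite /c mulrCA (bigD1 i)//=.
    rewrite big1 /dlt ?eqxx ?mulr1 ?addr0; last first.
      by move=> j ji; rewrite eq_sym (negbTE ji) mulr0.
    by congr (_ * _); rewrite mulrCA divff ?mulr1// gt_eqF ?atm_weight_gt0.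
  apply/funext => o'; rewrite (bigD1 o')//= /dlt eqxx mulr1 big1 ?addr0// => j jo.
  by rewrite eq_sym (negbTE jo) mulr0.
rewrite pairing_Dspace//.
transitivity (sumw (fun o' => trace k o u o' * D k c o')); last first.
  apply: eq_wsum => o'; have [e|ne] := pselect (block_of k o' = I).
    by rewrite trace_Delta_lift.
  by rewrite trace_out// !mul0r.
(* The projection of [c] may be replaced by [c]: the trace of [u] is adapted to level [k + 1] and
   has zero mean at level [k]. *)
rewrite (eq_wsum _ (f := fun o' => trace k o u o' * D k c o')
  (g := fun o' => trace k o u o' * E k.+1 c o' - trace k o u o' * E k c o')); last first.
  by move=> o'; rewrite mulrBr.
rewrite wsumB wsum_cexpr; [|exact: atm_weight_gt0|exact: adapted_trace].
have <- : sumw (fun o' => E k (trace k o u) o' * E k c o') =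
    sumw (fun o' => trace k o u o' * E k c o').
  by apply: (wsum_cexp atm_weight_gt0); exact: adapted_cexp.
rewrite [X in _ - X](eq_wsum _ (g := fun=> 0 * 0)); last first.
  by move=> o'; rewrite cexp_trace// mul0r mulr0.
by rewrite wsumZ mul0r subr0.
Qed.

End Block.

(** * Block operators on the window *)

Section Operators.
Context (mX : measurable (X : set (measurableTypeR R))).
Implicit Types (B : set R -> (R -> R) -> R -> R).

Definition level_op B k phi o : R :=
  if `[< (k < n)%N /\ rank_at k o >]
  then B (block_of k o) (Delta L (block_of k o) (lift phi)) (atm_point o) else 0.

Definition window_op B phi o : R := \sum_(0 <= k < n) level_op B k phi o.

Definition window_stable B := forall k o u, (k < n)%N -> rank_at k o ->
  Dspace L (block_of k o) u -> Dspace L (block_of k o) (B (block_of k o) u).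

Lemma level_op_trace B k phi o o' : (k < n)%N -> rank_at k o ->
  block_of k o' = block_of k o ->
  level_op B k phi o' =
  trace k o (B (block_of k o) (Delta L (block_of k o) (lift phi))) o'.
Proof.
by move=> kn rk e; rewrite /level_op /trace e eqxx asboolT.
Qed.

Lemma level_op0 B k phi o o' : ~ ((k < n)%N /\ rank_at k o) ->
  block_of k o' = block_of k o -> level_op B k phi o' = 0.
Proof. by move=> nrk e; rewrite /level_op e asboolF. Qed.

Lemma adapted_level_op B k phi : window_stable B -> adapt k.+1 (level_op B k phi).
Proof.
move=> Bst i j ij; have kij := block_of_refine ij.
have [[kn rk]|nrk] := pselect ((k < n)%N /\ rank_at k i); last first.
  by rewrite !(level_op0 B phi nrk).
rewrite !(level_op_trace B phi kn rk)//.
have Du := Bst _ _ _ kn rk (Dspace_Delta_lift k i phi).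
exact: (adapted_trace mX kn rk Du ij).
Qed.

Lemma cexp_level_op B k phi o : window_stable B -> E k (level_op B k phi) o = 0.
Proof.
move=> Bst; have [[kn rk]|nrk] := pselect ((k < n)%N /\ rank_at k o); last first.
  rewrite (eq_cexp_block _ (g := fun=> 0)) ?(cexp_adapted atm_weight_gt0)//.
  by move=> i ei; rewrite (level_op0 B phi nrk ei).
rewrite (eq_cexp_block _ (g :=
  trace k o (B (block_of k o) (Delta L (block_of k o) (lift phi))))).
  by apply: (cexp_trace mX) => //; apply: Bst => //; exact: Dspace_Delta_lift.
by move=> i ei; exact: level_op_trace.
Qed.

Lemma mdiff_window_op B k phi o : window_stable B -> (k < n)%N ->
  D k (window_op B phi) o = level_op B k phi o.
Proof.
move=> Bst kn; apply: (mdiff_diff_sequence atm_weight_gt0 block_of_refine) => //.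
  by move=> j; exact: adapted_level_op.
by move=> j i; exact: cexp_level_op.
Qed.

Lemma cexp0_window_op B phi o : window_stable B -> E 0 (window_op B phi) o = 0.
Proof.
move=> Bst; apply: (cexp0_diff_sequence atm_weight_gt0 block_of_refine) => //.
  by move=> j; exact: adapted_level_op.
by move=> j i; exact: cexp_level_op.
Qed.

(** Removing the averages of level 0 changes no martingale difference, and the blocks see only
    differences. *)
Lemma window_op_centered B phi :
  window_op B (fun o => phi o - E 0 phi o) = window_op B phi.
Proof.
apply/funext => o; apply: eq_big_nat => k /andP[_ kn]; rewrite /level_op.
case: asboolP => // -[_ rk]; congr (B _ _ _); apply: Delta_lift_eq => // o'.
rewrite /mdiff !cexpB !(cexp_adapted atm_weight_gt0 (f := E 0 phi)); first by ring.
  by apply: (adapted_le block_of_refine (leq0n k)); exact: adapted_cexp.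
by apply: (adapted_le block_of_refine (leq0n k.+1)); exact: adapted_cexp.
Qed.

(** Conditioning on level [k] takes [h] out and leaves an identity on one block, where both sides
    are pairings in [D_I] divided by the weight of the block. *)
Lemma window_op_adjoint B Bs k h phi psi :
  window_stable B -> window_stable Bs ->
  (forall k o u v, (k < n)%N -> rank_at k o ->
    Dspace L (block_of k o) u -> Dspace L (block_of k o) v ->
    pairing X (B (block_of k o) u) v = pairing X u (Bs (block_of k o) v)) ->
  (k < n)%N -> adapt k h ->
  sumw (fun o => h o * (D k (window_op B phi) o * D k psi o)) =
  sumw (fun o => h o * (D k phi o * D k (window_op Bs psi) o)).
Proof.
move=> Bst Bsst adj kn hk.
rewrite -[LHS](wsum_cexpr atm_weight_gt0 _ hk) -[RHS](wsum_cexpr atm_weight_gt0 _ hk).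
apply: eq_wsum => o; congr (_ * _).
have [rk|nrk] := pselect (rank_at k o); last first.
  apply: eq_cexp_block => o' e; rewrite !mdiff_no_rank ?e// ?mulr0 ?mul0r//.
have Du := Dspace_Delta_lift k o phi; have Dv := Dspace_Delta_lift k o psi.
have DBu := Bst _ _ _ kn rk Du; have DBv := Bsst _ _ _ kn rk Dv.
have traceE u v : E k (fun o' => trace k o u o' * trace k o v o') o =
    sumw (fun o' => trace k o u o' * trace k o v o') /
    (\sum_(o' | block_of k o' == block_of k o) atm_weight o').
  rewrite /cexp big_mkcond; congr (_ / _); apply: eq_bigr => i _.
  by rewrite /trace; case: (block_of k i == block_of k o); rewrite ?mul0r ?mulr0.
transitivity (E k (fun o' =>
    trace k o (B (block_of k o) (Delta L (block_of k o) (lift phi))) o' *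
    trace k o (Delta L (block_of k o) (lift psi)) o') o).
  apply: eq_cexp_block => o' e; rewrite mdiff_window_op//.
  by rewrite (level_op_trace B phi kn rk e) (trace_Delta_lift kn rk psi e).
rewrite traceE -(pairing_Dspace mX kn rk DBu Dv) (adj k o _ _ kn rk Du Dv).
rewrite (pairing_Dspace mX kn rk Du DBv) -traceE.
apply: eq_cexp_block => o' e; rewrite mdiff_window_op//.
by rewrite (level_op_trace Bs psi kn rk e) (trace_Delta_lift kn rk phi e).
Qed.

Lemma apply_blocks_window B f x : window_stable B ->
  (forall J, mem_lattice L J -> B J (cst 0) = cst 0) ->
  lattice_integrable L f ->
  (forall J, mem_lattice L J -> Delta L J f <> cst 0 ->
    exists k o, [/\ (k < n)%N, J = block_of k o & rank_at k o]) ->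
  apply_blocks L B f x = lift (window_op B (restr f)) x.
Proof.
move=> Bst B0 fint fsupp.
have DeltaE k o : (k < n)%N -> rank_at k o ->
    Delta L (block_of k o) f = Delta L (block_of k o) (lift (restr f)).
  move=> kn rk; apply/funext => y.
  have [Iy|nIy] := pselect (block_of k o y); last by rewrite !Delta_notin.
  have [i iy] := block_of_atm Iy.
  have e : block_of k i = block_of k o.
    by rewrite -(cell_atm (ltnW kn) iy) (block_of_eq Iy).
  by rewrite (Delta_block kn rk fint e iy) (Delta_lift_point kn rk _ e iy).
have supp J y : mem_lattice L J -> B J (Delta L J f) y <> 0 ->
    J y /\ exists k o, [/\ (k < n)%N, J = block_of k o & rank_at k o].
  move=> mJ BN0; have [|k [i [kn eJ rk]]] := fsupp J mJ.
    by move=> D0; apply: BN0; rewrite D0 B0.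
  split; last by exists k, i.
  apply: contrapT => nJy; apply: BN0; rewrite eJ (DeltaE _ _ kn rk).
  have [+ _] := DspaceP mX kn rk (Bst _ _ _ kn rk (Dspace_Delta_lift k i (restr f))).
  by apply; rewrite -eJ.
rewrite /apply_blocks; have [[i ix]|nx] := lift_cases x; last first.
  rewrite lift_notin// fsbig1// => J mJ; apply: contrapT => BN0.
  have [Jx [k [i [kn eJ _]]]] := supp J x mJ BN0.
  by move: Jx; rewrite eJ => /block_of_atm[j]; exact: nx.
rewrite (@sum_lattice (fun J => B J (Delta L J f)) i x ix); last first.
  move=> J mJ /(supp _ _ mJ)[Jx [k [j [kn eJ rk]]]]; split=> //.
  by exists k => //; rewrite eJ.
rewrite (lift_atm _ ix); apply: eq_big_nat => k /andP[_ kn]; rewrite /level_op.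
have [rk|nrk] := pselect (rank_at k i); last by rewrite !asboolF// => -[].
rewrite !asboolT// (DeltaE _ _ kn rk).
exact: (Dspace_point mX kn rk (Bst _ _ _ kn rk (Dspace_Delta_lift k i (restr f))) ix).
Qed.

End Operators.

(** * BMO on the window *)

Lemma mdiff_restr_jump b j o : (j < n)%N -> lattice_integrable L b ->
  D j (restr b) o != 0 ->
  jump L (fun I => Delta L I b) (block_of j.+1 o) = D j (restr b) o.
Proof.
move=> jn bint DN0; have rk : rank_at j o.
  by apply: contrapT => /mdiff_no_rank D0; move: DN0; rewrite D0 eqxx.
apply: (@jump_child _ _ _ _ (block_of j o)).
  exists (k0 + j%:Z); split=> //; first by rewrite window_indexS; exact: block_of_gen.
  exact: block_of_le.
move=> x bx; have [i ix] := block_of_atm bx.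
have e : block_of j.+1 i = block_of j.+1 o.
  by rewrite -(cell_atm jn ix) (block_of_eq bx).
rewrite (Delta_block jn rk bint (block_of_refine e) ix).
have A : adapt j.+1 (D j (restr b)) by apply: adapted_mdiff; exact: block_of_refine.
exact: A.
Qed.

(** If [i < j] and the blocks of levels [i + 1] and [j + 1] agree, the block of level [j] is
    squeezed between them. It then recurs in the next generation and carries no difference. *)
Lemma block_of_level_inj b i j o :
  D i (restr b) o != 0 -> D j (restr b) o != 0 ->
  block_of i.+1 o = block_of j.+1 o -> i = j.
Proof.
have lt_case i' j' : (i' < j')%N -> D j' (restr b) o != 0 ->
    block_of i'.+1 o = block_of j'.+1 o -> False.
  move=> ij DN0 e; move: DN0; rewrite mdiff_no_rank ?eqxx// => rk.
  have ej : block_of j' o = block_of j'.+1 o.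
    by apply/seteqP; split; [rewrite -e|]; exact: block_of_le.
  have := rk.2 (k0 + j'.+1%:Z); rewrite ej => /(_ (block_of_gen _ _)).
  by rewrite lerD2l lez_nat ltnn.
move=> DiN0 DjN0 e; have [ij|ji|//] := ltngtP i j.
  by case: (lt_case _ _ ij DjN0 e).
by case: (lt_case _ _ ji DiN0 (esym e)).
Qed.

Lemma measure_block k o : (k <= n)%N ->
  fine (mu (block_of k o)) = \sum_(o' | block_of k o' == block_of k o) atm_weight o'.
Proof.
move=> kn; rewrite {1}(block_of_bigsetU o kn) measure_atms; last by rewrite filter_uniq// enum_uniq.
by rewrite big_filter big_enum_cond/=; apply: eq_bigl => o'; rewrite ?andbT.
Qed.

(* Each interval [I] below [J] is counted once: it determines its parent, hence
   the level [j] with [I] in generation [k0 + j + 1] at which it is a child. *)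
Lemma bmo_le_restr (B : R) b : 0 <= B -> lattice_integrable L b ->
  (BMO_norm L (fun I => Delta L I b) <= B%:E)%E ->
  bmo_le atm_weight block_of n B (restr b).
Proof.
move=> B0 bint bB k h kn hk h0.
rewrite -(wsum_cexpr atm_weight_gt0 _ hk) -[leRHS](wsum_cexpr atm_weight_gt0 _ hk).
apply: (ler_wsum atm_weight_gt0) => o; apply: ler_wpM2l => //.
rewrite [leRHS](cexp_adapted atm_weight_gt0)//.
rewrite /cexp ler_pdivrMr; last exact: block_weight_gt0 atm_weight_gt0 _ _.
rewrite -(measure_block o kn).
(* The jump into [J] itself is the difference of level [k], so the BMO sum over [J] covers a tail
   starting at [k]. *)
set J := block_of k.+1 o; set x := jump L (fun I => Delta L I b).
pose js o' := [seq j <- index_iota k n | D j (restr b) o' != 0].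
(* Several atoms list the same interval, hence [undup]. Keeping only levels with a nonzero
   difference makes the intervals along one atom distinct. *)
pose r := undup (flatten
  [seq [seq block_of j.+1 o' | j <- js o'] | o' <- enum Om & block_of k.+1 o' == J]).
have rP I : I \in r -> exists j o', [/\ (k <= j < n)%N, block_of k.+1 o' = J &
    I = block_of j.+1 o'].
  rewrite mem_undup => /flattenP[s /mapP[i + ->]] /mapP[j + ->].
  rewrite !mem_filter mem_index_iota => /andP[/eqP e _] /andP[_ kj].
  by exists j, i.
rewrite -lee_fin; apply: le_trans (BMO_norm_ge (block_of_gen k.+1 o) bB B0).
apply: esum_ge; exists [set` r].
  split; first exact: finite_seq.
  move=> I /= /rP[j [i [/andP[kj jn] e ->]]]; split.
    by exists (k0 + j.+1%:Z) => //; exact: block_of_gen.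
  by rewrite -/J -e; exact: block_of_le.
rewrite -fsbig_seq ?undup_uniq// sumEFin lee_fin -/x.
(* Spreading the measure of each interval over its atoms allows a comparison atom by atom. *)
have -> : \sum_(I <- r) `|x I| ^+ 2 * fine (mu I) =
    \sum_o' atm_weight o' * \sum_(I <- r | `[< atm o' `<=` I >]) `|x I| ^+ 2.
  transitivity (\sum_(I <- r) \sum_o'
      if `[< atm o' `<=` I >] then atm_weight o' * `|x I| ^+ 2 else 0).
    rewrite !big_seq; apply: eq_bigr => I /rP[j [i [/andP[_ jn] _ ->]]].
    rewrite measure_block// mulr_sumr big_mkcond; apply: eq_bigr => o' _.
    rewrite mulrC; congr (if _ then _ else _).
    apply/eqP/asboolP => [<-|H]; first exact: atm_sub_block.
    by rewrite -(block_of_eq (H _ (mem_atm_point o'))).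
  rewrite exchange_big/=; apply: eq_bigr => o' _.
  by rewrite mulr_sumr [RHS]big_mkcond.
rewrite big_mkcond/=; apply: ler_sum => o' _; case: ifPn => [/eqP e|_]; last first.
  by rewrite mulr_ge0 ?(ltW (atm_weight_gt0 _))// sumr_ge0// => I _; rewrite exprn_ge0.
apply: ler_wpM2l; first exact/ltW/atm_weight_gt0.
rewrite -[leRHS]big_filter.
apply: (@le_trans _ _ (\sum_(I <- [seq block_of j.+1 o' | j <- js o']) `|x I| ^+ 2)).
  rewrite big_map big_filter [leRHS]big_mkcond big_seq [leRHS]big_seq.
  apply: ler_sum => j; rewrite mem_index_iota => /andP[_ jn].
  case: ifPn => [DN0|]; last by rewrite negbK => /eqP ->; rewrite expr0n.
  by rewrite /x mdiff_restr_jump// real_normK ?num_real.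
apply: ler_sum_uniq_subset.
- rewrite map_inj_in_uniq ?filter_uniq ?iota_uniq// => i j.
  by rewrite !mem_filter => /andP[Di _] /andP[Dj _]; exact: block_of_level_inj Di Dj.
- by rewrite filter_uniq// undup_uniq.
- move=> I /mapP[j jjs ->]; rewrite mem_filter; apply/andP; split.
    apply/asboolP; apply: atm_sub_block.
    by move: jjs; rewrite mem_filter mem_index_iota => /and3P[].
  rewrite mem_undup; apply/flattenP.
  exists [seq block_of j.+1 o' | j <- js o']; last exact: map_f.
  by apply/mapP; exists o' => //; rewrite mem_filter e eqxx mem_enum.
- by move=> I; rewrite exprn_ge0.
Qed.

(** * The commutator on a window *)

Section Commutator.
Context (mX : measurable (X : set (measurableTypeR R))) (T : martingale_transform L).

Lemma window_stable_block : window_stable (block T).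
Proof.
move=> k o u kn rk; apply: block_stable; exists (k0 + k%:Z) => //.
exact: block_of_gen.
Qed.

Lemma adjoint_blockP k o v : (k < n)%N -> rank_at k o -> Dspace L (block_of k o) v ->
  Dspace L (block_of k o) (adjoint_block T (block_of k o) v) /\
  forall u, Dspace L (block_of k o) u ->
    pairing X (block T (block_of k o) u) v =
    pairing X u (adjoint_block T (block_of k o) v).
Proof.
move=> kn rk Dv; have mI : mem_lattice L (block_of k o).
  by exists (k0 + k%:Z) => //; exact: block_of_gen.
have [w wP] := adjoint_exists mX kn rk (@block_stable _ _ _ T _ mI)
    (@block_linear _ _ _ T _ mI) Dv.
by rewrite /adjoint_block; case: xgetP => [w' _ //|/(_ w)].
Qed.

Lemma window_stable_adjoint_block : window_stable (adjoint_block T).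
Proof. by move=> k o v kn rk /(adjoint_blockP kn rk)[]. Qed.

(* The window sees all of [f] except for a constant on each interval of
   generation [k0]. *)
Definition captured f : Prop :=
  (forall J, mem_lattice L J -> Delta L J f <> cst 0 ->
    exists k o, [/\ (k < n)%N, J = block_of k o & rank_at k o]) /\
  (forall o x, atm o x -> f x = f (atm_point o)).

Lemma captured_restr f o x : captured f -> atm o x -> f x = restr f o.
Proof.
move=> [_ fc] ox; rewrite (fc _ _ ox); symmetry.
exact: (avg_cst (atm_gen o) (fun y oy => fc o y oy)).
Qed.

Lemma finite_sum_integrable f : finite_sum L f -> lattice_integrable L f.
Proof. by move=> [_ fint _ _ _] I mI; apply: fint; left. Qed.

Lemma commutator_form_window b f g :
  (forall J, mem_lattice L J -> block T J (cst 0) = cst 0) ->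
  (forall J, mem_lattice L J -> adjoint_block T J (cst 0) = cst 0) ->
  admissible L b -> lattice_integrable L b ->
  finite_sum L f -> finite_sum L g -> captured f -> captured g ->
  commutator_form b T f g =
  sumw (fun o => restr b o * (window_op (block T) (restr f) o * restr g o)) -
  sumw (fun o => restr b o * (restr f o * window_op (adjoint_block T) (restr g) o)).
Proof.
move=> T0 Ts0 [mb _] bint fs gs fc gc.
have mbA : measurable_fun (\bigcup_o atm o : set (measurableTypeR R)) b.
  by apply: measurable_funS mX _ mb => x [i _]; exact: atm_subX.
have bintA o : mu.-integrable (atm o) (EFin \o b).
  by apply: bint; exists (k0 + n%:Z) => //; exact: atm_gen.
have lift_mul phi psi x : lift (fun o => phi o * psi o) x = lift phi x * lift psi x.
  have [[i ix]|nx] := lift_cases x; first by rewrite !(lift_atm _ ix).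
  by rewrite !lift_notin// mul0r.
(* Off the atoms [h] is not controlled, but the factor [lift phi] vanishes there. *)
have lift_restr h x phi : captured h -> lift phi x * h x = lift phi x * lift (restr h) x.
  move=> hc; have [[i ix]|nx] := lift_cases x.
    by rewrite !(lift_atm _ ix) (captured_restr hc ix).
  by rewrite !(lift_notin phi)// !mul0r.
rewrite /commutator_form /pairing; congr (_ - _).
  transitivity (\int[mu]_(x in X)
      (lift (fun o => window_op (block T) (restr f) o * restr g o) x * b x)).
    apply: eq_Rintegral => x _; rewrite /transform.
    rewrite (apply_blocks_window mX _ window_stable_block T0 (finite_sum_integrable fs) fc.1).
    by rewrite lift_mul -lift_restr//; ring.
  rewrite Rintegral_liftM//; last exact: atm_subX.
  by apply: eq_wsum => o; rewrite mulrC.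
transitivity (\int[mu]_(x in X)
    (lift (fun o => restr f o * window_op (adjoint_block T) (restr g) o) x * b x)).
  apply: eq_Rintegral => x _; rewrite /adjoint_transform.
  rewrite (apply_blocks_window mX _ window_stable_adjoint_block Ts0
    (finite_sum_integrable gs) gc.1).
  rewrite lift_mul; set y := lift (window_op _ _) x.
  have H : y * f x = y * lift (restr f) x by exact: lift_restr.
  by transitivity (b x * (y * f x)); [|rewrite H]; ring.
rewrite Rintegral_liftM//; last exact: atm_subX.
by apply: eq_wsum => o; rewrite mulrC.
Qed.

Lemma commutator_form_le (p N B : R) b f g : 1 < p -> 0 <= N -> 0 < B ->
  (forall J, mem_lattice L J -> block T J (cst 0) = cst 0) ->
  (forall J, mem_lattice L J -> adjoint_block T J (cst 0) = cst 0) ->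
  (forall f, finite_sum L f ->
    (Lpnorm X p%:E (transform T f) <= N%:E * Lpnorm X p%:E f)%E) ->
  admissible L b -> lattice_integrable L b ->
  (BMO_norm L (fun I => Delta L I b) <= B%:E)%E ->
  finite_sum L f -> finite_sum L g -> captured f -> captured g ->
  `|commutator_form b T f g| <=
    2 * paraproduct_const p * centering_const p * N * B *
    lpnorm atm_weight p (restr f) * lpnorm atm_weight (p / (p - 1)) (restr g).
Proof.
move=> p1 N0 B0 T0 Ts0 TN badm bint bB fs gs fc gc.
have q1 := conjugate_exponent_gt1 p1.
have p0 := lt_trans ltr01 p1; have q0 := lt_trans ltr01 q1.
rewrite (commutator_form_window T0 Ts0 badm bint fs gs fc gc).
apply: (wsum_commutator_le atm_weight_gt0 block_of_refine (n := n)) => //.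
- exact: block_of_inj.
- exact: bmo_le_restr (ltW B0) bint bB.
- by move=> F o; apply: (cexp0_window_op mX); exact: window_stable_block.
- by move=> F o; apply: (cexp0_window_op mX); exact: window_stable_adjoint_block.
- move=> k h F G kn hk; apply: (window_op_adjoint mX) => //.
  + exact: window_stable_block.
  + exact: window_stable_adjoint_block.
  + by move=> j o u v jn rk Du Dv; have [_] := adjoint_blockP jn rk Dv; apply.
- by move=> F; exact: (window_op_centered mX).
(* A centered window function lifts to a finite sum, to which the assumed bound for [T] applies. *)
- move=> F F0; rewrite -lee_fin EFinM -!Lpnorm_lift//.
  apply: le_trans (TN _ (finite_sum_lift F0)); rewrite le_eqVlt; apply/orP; left.
  apply/eqP; congr Lpnorm; apply/funext => x; rewrite /transform.
  rewrite (apply_blocks_window mX _ window_stable_block T0) ?restr_lift//.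
    exact: lattice_integrable_lift.
  by move=> J _; exact: Delta_lift_support.
Qed.

Lemma lpnorm_restr_le (p : R) f : 0 < p -> finite_sum L f -> captured f ->
  ((lpnorm atm_weight p (restr f))%:E <= Lpnorm X p%:E f)%E.
Proof.
move=> p0 [[mf _] _ _ _ _] fc; apply: le_lpnorm_Lpnorm => // o x.
exact: captured_restr.
Qed.

End Commutator.

End Window.

(** * Windows capturing finite sums *)

Section WindowExistence.
Context {R : realType} {X : set R} (L : lattice X).
Implicit Types (I J K : set R) (f g : R -> R).

Lemma window_exists (k0 : int) (n : nat) (Rts : set (set R)) :
  finite_set Rts -> Rts `<=` L k0 ->
  exists (Om : finType) (atm : Om -> set R),
    [/\ forall o, L (k0 + n%:Z) (atm o),
        injective atm,
        forall o K J, L k0 K -> atm o `<=` K ->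
          L (k0 + n%:Z) J -> J `<=` K -> exists o', atm o' = J &
        forall K J, Rts K -> L (k0 + n%:Z) J -> J `<=` K -> exists o, atm o = J].
Proof.
move=> Rfin RL.
pose A : set (set R) := \bigcup_(K in Rts) [set J | L (k0 + n%:Z) J /\ J `<=` K].
have Afin : finite_set A.
  by apply: bigcup_finite => // K /RL; exact: gen_finite.
have [s As] := (finite_seqP A).1 Afin.
exists (seq_sub s), (@ssval _ s).
have valA (i : seq_sub s) : A (ssval i) by rewrite As; exact: ssvalP.
have lift_set J : A J -> exists i : seq_sub s, ssval i = J.
  by rewrite As => Js; exists (SeqSub Js).
split.
- by move=> o; have [K _ []] := valA o.
- exact: val_inj.
- move=> o K J LK oK LJ JK; apply: lift_set; have [K' RK' [Lo oK']] := valA o.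
  have [x ox] := gen_neq0 Lo.
  exists K => //; rewrite -(gen_eq (RL _ RK') LK (oK' _ ox) (oK _ ox))//.
- by move=> K J RK LJ JK; apply: lift_set; exists K.
Qed.

Lemma pairing0 u : pairing X u (cst 0) = 0.
Proof.
rewrite /pairing (eq_Rintegral _ (g := cst 0)); last by move=> x _; rewrite mulr0.
by rewrite /Rintegral integral0_eq.
Qed.

Lemma avg0 I : avg I (cst 0 : R -> R) = 0.
Proof. by rewrite /avg /Rintegral integral0_eq ?mulr0. Qed.

Lemma Delta0 I : Delta L I (cst 0) = cst 0.
Proof.
have [[k rk]|/Delta_no_rank -> //] := pselect (exists k, is_rank L I k).
apply/funext => x; have [Ix|nIx] := pselect (I x); last by rewrite Delta_notin.
by rewrite (Delta_rank _ rk Ix) !avg0 subrr.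
Qed.

Lemma Dspace0 I : Dspace L I (cst 0).
Proof.
exists (cst 0); split; last by rewrite Delta0.
  by split=> //; exact: measurable_cst.
rewrite /Lpnorm (_ : EFin \o _ = cst 0%E) ?Lnorm0 ?ltry ?eqe ?pnatr_eq0//.
by apply/funext => x; rewrite /= patchE; case: ifP.
Qed.

Lemma block0 (T : martingale_transform L) I : mem_lattice L I -> block T I (cst 0) = cst 0.
Proof.
move=> mI; have := @block_linear _ _ _ T I mI 1 _ _ (Dspace0 I) (Dspace0 I).
rewrite (_ : (fun x => _) = cst 0); last by apply/funext => x /=; rewrite mulr0 addr0.
by move=> e; apply/funext => x; have := congr1 (@^~ x) e => /=; lra.
Qed.

(** Any [w] selected by [xget] pairs to zero with every element of [D_I], in particular with itself.
    Without a rank, [D_I] contains only 0. *)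
Lemma adjoint_block0 (T : martingale_transform L) I :
  measurable (X : set (measurableTypeR R)) -> mem_lattice L I ->
  adjoint_block T I (cst 0) = cst 0.
Proof.
move=> mX mI; rewrite /adjoint_block; case: xgetP => // w _ [Dw wP].
have [[m rm]|nrk] := pselect (exists m, is_rank L I m); last first.
  by move: Dw => [f [_ _ ->]]; exact: Delta_no_rank.
have LI := is_rank_gen rm.
have Rfin : finite_set [set I] by exact: finite_set1.
have RL : [set I] `<=` L m by move=> _ ->.
(* A window with root [I] and depth one, so that [I] is a block of level 0 and definiteness of the
   pairing is available. *)
have [Om [atm [ag ai asat acov]]] := window_exists 1 Rfin RL.
have [x Ix] := gen_neq0 LI; have Xx := gen_subX LI Ix.
have JI : cell L (m + 1%:Z) x `<=` I by rewrite -(cell_eq LI Ix); exact: cellS.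
have [i io] := acov _ _ erefl (cell_gen L (m + 1%:Z) Xx) JI.
have e : block_of L atm m 0 i = I.
  rewrite /block_of addr0; apply: cell_eq LI _; apply: JI; rewrite -io.
  exact: mem_atm_point.
rewrite -e in Dw *.
apply: (pairing_definite ag ai asat mX (ltn0Sn 0) _ Dw).
  by rewrite e addr0.
rewrite -wP ?e ?pairing0//; rewrite -e//.
Qed.

Lemma rank_window (F : set (set R)) : finite_set F ->
  exists (k0 : int) (n : nat), forall I m, F I -> is_rank L I m -> k0 <= m < k0 + n%:Z.
Proof.
move=> /finite_seqP[s ->]; elim: s => [|I s [k0 [n IH]]].
  by exists 0, 0%N => I m.
have [[m rm]|nrk] := pselect (exists m, is_rank L I m); last first.
  exists k0, n => J j; rewrite /= inE => /predU1P[-> rj|]; last exact: IH.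
  by exfalso; apply: nrk; exists j.
exists (Num.min k0 m), (absz (Num.max (k0 + n%:Z) (m + 1) - Num.min k0 m)%R) => J j.
have le0 : Num.min k0 m <= Num.max (k0 + n%:Z) (m + 1).
  by rewrite ge_min le_max; apply/orP; left; rewrite lerDl.
rewrite gez0_abs ?subr_ge0// subrKC ge_min lt_max /= inE => /predU1P[-> rj|Js rj].
  by rewrite (is_rank_uniq rj rm) lexx orbT ltrDl ltr01 orbT.
by have /andP[-> ->] := IH J j Js rj.
Qed.

(** Each term is constant on [a]: intervals of rank [k < m], their children, and the top intervals
    all contain or miss [a]. *)
Lemma finite_sum_fine f m a x y : finite_sum L f ->
  (forall I k, mem_lattice L I -> Delta L I f <> cst 0 -> is_rank L I k -> k < m) ->
  L m a -> a x -> a y -> f x = f y.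
Proof.
move=> [_ _ _ _ fE] km La ax ay; have aX := gen_subX La.
rewrite !fE; [|exact: aX..]; congr (_ + _).
  apply: eq_fsbigr => I; rewrite inE => mI.
  have [->//|DN0] := pselect (Delta L I f = cst 0).
  have [[k rk]|/Delta_no_rank D0] := pselect (exists k, is_rank L I k); last first.
    by case: DN0.
  have k1m : k + 1 <= m by rewrite lezD1; exact: km mI DN0 rk.
  have kle : k <= m by apply: le_trans k1m; rewrite lerDl.
  have aI z : I z -> a z -> a `<=` I by move=> Iz az; exact: gen_nested kle (is_rank_gen rk) La Iz az.
  have [Ix|nIx] := pselect (I x); last first.
    by rewrite !Delta_notin// => Iy; apply: nIx; exact: aI Iy ay _ ax.
  have c : cell L (k + 1) y = cell L (k + 1) x.
    apply: cell_eq; first exact: cell_gen (aX _ ax).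
    exact: gen_nested k1m (cell_gen L _ (aX _ ax)) La (mem_cell L _ (aX _ ax)) ax _ ay.
  by rewrite (Delta_rank _ rk Ix) (Delta_rank _ rk (aI _ Ix ax _ ay)) c.
apply: eq_fsbigr => I; rewrite inE => -[tI _]; rewrite /Expect; congr (_ * _).
rewrite !indicE; congr (_%:R); congr nat_of_bool.
have [aI|aI] := top_dichotomy tI La; first by rewrite !mem_set//; exact: aI.
by rewrite !memNset// => /aI.
Qed.

Lemma window_captures f g : finite_sum L f -> finite_sum L g ->
  exists (k0 : int) (n : nat) (Om : finType) (atm : Om -> set R),
    [/\ forall o, L (k0 + n%:Z) (atm o),
        injective atm,
        forall o K J, L k0 K -> atm o `<=` K ->
          L (k0 + n%:Z) J -> J `<=` K -> exists o', atm o' = J,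
        captured L atm k0 n f & captured L atm k0 n g].
Proof.
move=> fs gs.
pose S h := [set I | mem_lattice L I /\ Delta L I h <> cst 0].
have Sfin : finite_set (S f `|` S g).
  by rewrite finite_setU; split; [case: fs|case: gs].
have [k0 [n kn]] := rank_window Sfin.
have Sranked I : (S f `|` S g) I -> exists m, is_rank L I m.
  by move=> SI; apply: contrapT => /Delta_no_rank D0; case: SI => -[_]; apply; rewrite D0.
(* The roots: every interval carrying a difference of [f] or [g] has rank at least [k0], hence lies
   in the interval of generation [k0] through its chosen point. *)
have Rfin : finite_set [set cell L k0 (xget 0 I) | I in S f `|` S g].
  exact: finite_image.
have ptP I : (S f `|` S g) I -> I (xget 0 I).
  move=> /Sranked[m /is_rank_gen/gen_neq0[x Ix]].
  by case: xgetP => [y _ //|/(_ x)].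
have RL : [set cell L k0 (xget 0 I) | I in S f `|` S g] `<=` L k0.
  move=> _ [I SI <-]; apply: cell_gen; have [m rm] := Sranked I SI.
  exact: gen_subX (is_rank_gen rm) _ (ptP I SI).
have [Om [atm [ag ai asat acov]]] := window_exists n Rfin RL.
exists k0, n, Om, atm.
have cap h : finite_sum L h -> S h `<=` S f `|` S g -> captured L atm k0 n h.
  move=> hs hS; split.
    move=> I mI DN0; have SI : (S f `|` S g) I by apply: hS.
    have [m rm] := Sranked I SI; have LI := is_rank_gen rm.
    have /andP[k0m mn] := kn I m SI rm.
    have Ix := ptP I SI; set x := xget 0 I in Ix; have Xx := gen_subX LI Ix.
    have em : k0 + `|m - k0|%N%:Z = m by rewrite gez0_abs ?subr_ge0// subrKC.
    have cK : cell L (k0 + n%:Z) x `<=` cell L k0 x by exact: cell_le.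
    have [i io] := acov _ _ (imageP _ SI) (cell_gen L (k0 + n%:Z) Xx) cK.
    have e : I = block_of L atm k0 `|m - k0| i.
      apply/esym; rewrite /block_of em; apply: (cell_eq LI).
      rewrite -(cell_eq LI Ix); apply: (cell_anti Xx (ltW mn)).
      by rewrite -io; exact: mem_atm_point.
    exists `|m - k0|%N, i; split=> //; last by rewrite -e em.
    by rewrite -ltz_nat -(ltrD2l k0) em.
  move=> o x ox; apply: finite_sum_fine hs _ (ag o) ox (mem_atm_point ag o).
  move=> I k mI DN0 rk; have SI : (S f `|` S g) I by apply: hS.
  by have /andP[] := kn I k SI rk.
by split=> //; apply: cap => // I SI; first [by left | by right].
Qed.

End WindowExistence.

(** * Passage from strict upper bounds to the norms *)

Lemma hoelder_conjugate_EFin (R : realType) (p : R) : 1 < p ->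
  hoelder_conjugate p%:E = (p / (p - 1))%:E.
Proof.
move=> p1; rewrite /hoelder_conjugate/= eqe gt_eqF ?(lt_trans _ p1)//.
by rewrite -EFinB inver gt_eqF ?subr_gt0// -EFinM.
Qed.

Lemma ler_mul_limit (R : realType) (z a b c : R) : 0 <= a -> 0 <= b -> 0 <= c ->
  (forall s t, a < s -> b < t -> z <= c * s * t) -> z <= c * a * b.
Proof.
move=> a0 b0 c0 H; rewrite leNgt; apply/negP => zl.
(* For [e <= 1] the product at [a + e], [b + e] exceeds [c a b] by at most [e c (a + b + 1)],
   strictly less than [e K]. *)
pose K := c * (a + b + 1) + 1.
have K0 : 0 < K by rewrite /K ltr_wpDl// mulr_ge0// !addr_ge0.
pose e := Num.min 1 ((z - c * a * b) / K).
have e0 : 0 < e by rewrite lt_min ltr01 divr_gt0// subr_gt0.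
have e1 : e <= 1 by rewrite ge_min lexx.
have eK : e * K <= z - c * a * b by rewrite -ler_pdivlMr// ge_min lexx orbT.
have := H (a + e) (b + e); rewrite !ltrDl e0 => /(_ isT isT).
have : c * e * e <= c * e by rewrite ler_piMr// mulr_ge0// ltW.
by move: eK; rewrite /K; nra.
Qed.

Unset Implicit Arguments.
Set Strict Implicit.
Set Printing Implicit Defensive.

Theorem proposition5p1 (R : realType) (p : R) (hp : 1 < p) :
  exists C : R, 0 <= C /\
    forall (X : set R) (hX : is_interval X) (hX0 : X !=set0)
      (L : lattice X) (T : martingale_transform L) (b : R -> R)
      (hT : (transform_norm p T < +oo)%E)
      (hb : admissible L b) (hbint : lattice_integrable L b)
      (hBMO : (BMO_norm L (fun I => Delta L I b) < +oo)%E),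
      (commutator_norm p b T < +oo)%E /\
      (commutator_norm p b T
         <= C%:E * transform_norm p T * BMO_norm L (fun I => Delta L I b))%E.
Proof.
have [C [C0 CE]] : exists C : R, 0 <= C /\ C = 2 * paraproduct_const p * centering_const p.
  exists (2 * paraproduct_const p * centering_const p); split=> //.
  apply: mulr_ge0; last exact: powR_ge0.
  by apply: mulr_ge0 => //; exact: paraproduct_const_ge0.
exists C; split=> // X hX [x0 Xx0] L T b hT hb hbint hBMO.
have mX : measurable (X : set (measurableTypeR R)) by exact: is_interval_measurable.
have p0 := lt_trans ltr01 hp.
have q0 := lt_trans ltr01 (conjugate_exponent_gt1 hp).
have tn0 : (0 <= transform_norm p T)%E.
  by apply: le_ereal_inf_tmp => _ [N [N0 _] <-]; rewrite lee_fin.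
have bn0 : (0 <= BMO_norm L (fun I => Delta L I b))%E.
  (* The supremum of an empty family would be [-oo]; the point [x0] of [X] supplies an interval. *)
  apply: le_trans (ereal_sup_ubound _); last first.
    by exists (cell L 0 x0) => //; exists 0 => //; exact: cell_gen.
  exact: poweR_ge0.
have [t tE] : exists t, transform_norm p T = t%:E.
  by exists (fine (transform_norm p T)); rewrite fineK// ge0_fin_numE.
have [B BE] : exists B, BMO_norm L (fun I => Delta L I b) = B%:E.
  by exists (fine (BMO_norm L (fun I => Delta L I b))); rewrite fineK// ge0_fin_numE.
rewrite tE BE -!EFinM; rewrite tE lee_fin in tn0; rewrite BE lee_fin in bn0.
suff H : (commutator_norm p b T <= (C * t * B)%:E)%E.
  by split=> //; apply: le_lt_trans H (ltry _).
apply: ereal_inf_lbound; exists (C * t * B) => //; split.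
  by apply: mulr_ge0 => //; exact: mulr_ge0.
move=> f g fs gs.
have [k0 [n [Om [atm [ag ai asat fc gc]]]]] := window_captures fs gs.
set x := lpnorm (atm_weight atm) p (restr atm f).
set y := lpnorm (atm_weight atm) (p / (p - 1)) (restr atm g).
have x0' : 0 <= x by exact: lpnorm_ge0.
have y0 : 0 <= y by exact: lpnorm_ge0.
(* Above the infimum [t], [N] is a valid constant for [T], with no need to know that [t] is
   attained; and [B'] is positive even when [B = 0]. *)
have main N B' : t < N -> B < B' -> `|commutator_form b T f g| <= C * N * B' * x * y.
  move=> tN BB'; rewrite CE.
  have N0 : 0 <= N := ltW (le_lt_trans tn0 tN).
  have B0' : 0 < B' := le_lt_trans bn0 BB'.
  apply: (commutator_form_le ag ai asat mX hp N0 B0') => //.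
  - by move=> J; exact: block0.
  - by move=> J; exact: adjoint_block0.
  - move=> h hs; have [_ [N' [_ TN'] <-]] : exists2 z : \bar R,
        [set N%:E | N in [set N : R | 0 <= N /\ forall f, finite_sum L f ->
          (Lpnorm X p%:E (transform T f) <= N%:E * Lpnorm X p%:E f)%E]] z &
        (z < N%:E)%E.
      by apply: ereal_inf_lt; rewrite -/(transform_norm p T) tE lte_fin.
    rewrite lte_fin => NN'; apply: le_trans (TN' h hs) _.
    by apply: lee_wpmul2r; [exact: Lnorm_ge0|rewrite lee_fin ltW].
  - by rewrite BE lee_fin ltW.
have xL : (x%:E <= Lpnorm X p%:E f)%E := lpnorm_restr_le ag ai mX p0 fs fc.
have yL : (y%:E <= Lpnorm X (p / (p - 1))%:E g)%E := lpnorm_restr_le ag ai mX q0 gs gc.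
clearbody x y.
have Cxy0 : 0 <= C * x * y by apply: mulr_ge0 => //; exact: mulr_ge0.
have CtB0 : 0 <= C * t * B by apply: mulr_ge0 => //; exact: mulr_ge0.
rewrite hoelder_conjugate_EFin//.
apply: (@le_trans _ _ ((C * t * B * x)%:E * y%:E)%E).
  rewrite -EFinM lee_fin; have -> : C * t * B * x * y = C * x * y * t * B by ring.
  apply: ler_mul_limit tn0 bn0 Cxy0 _ => N B' tN BB'.
  have -> : C * x * y * N * B' = C * N * B' * x * y by ring.
  exact: main.
rewrite EFinM; apply: lee_pmul => //.
- by rewrite -EFinM lee_fin; exact: mulr_ge0.
- by apply: lee_pmul => //; rewrite lee_fin.
Qed.
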